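(* Let $(\bar M,\bar g)$ be an $(n+2)$-dimensional pseudo-Riemannian manifold of index $\nu$ with $0<\nu<n+2$, and let $M\subset\bar M$ be a lightlike hypersurface with induced degenerate metric $g$. Then $(M,g)$ is totally umbilical if and only if it admits a Weyl connection, i.e. if and only if there exist a torsion-free linear connection $\nabla$ on $M$ and a smooth $1$-form $\theta$ on $M$ such that $\nabla g=\theta\otimes g$.
   Context: All objects are smooth. A hypersurface $M$ of $(\bar M,\bar g)$ is lightlike if the induced symmetric tensor $g=\bar g|_{TM}$ has constant rank $n$ on $M$ (note $\dim M=n+1$). Equivalently, the normal bundle $TM^\perp=\bigcup_{x\in M}T_xM^\perp$ is a rank-one distribution on $M$ contained in $TM$; it is then equal to the radical distribution $\mathrm{Rad}\,TM=TM\cap TM^\perp$ (the kernel of $g$). Let $\bar\nabla$ be the Levi-Civita connection of $\bar g$. For a nowhere zero local section $\xi$ of $TM^\perp$ on a coordinate neighbourhood $\mathcal U\subset M$, the (local) second fundamental form of $M$ is $B(X,Y)=\bar g(\bar\nabla_XY,\xi)$ for $X,Y\in\Gamma(TM|_{\mathcal U})$. It is a symmetric bilinear form. $(M,g)$ is totally umbilical if on each coordinate neighbourhood $\mathcal U\subset M$ there is a smooth function $\lambda$ with $B(X,Y)=\lambda\, g(X,Y)$ for all $X,Y\in\Gamma(TM|_{\mathcal U})$. This does not depend on the choice of $\xi$. A linear connection $\nabla$ on $M$ is called conformal if there is a smooth $1$-form $\theta$ on $M$ with $\nabla g=\theta\otimes g$, i.e. $(\nabla_Xg)(Y,Z)=\theta(X)g(Y,Z)$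 for all $X,Y,Z\in\Gamma(TM)$. A Weyl connection is a conformal connection that is torsion-free. *)

(* Defs.v *)
From mathcomp Require Import all_boot all_order all_algebra.
From mathcomp Require Import all_classical all_reals all_analysis.
Import Order.TTheory GRing.Theory Num.Theory.
Import numFieldNormedType.Exports.

Set Implicit Arguments.
Unset Strict Implicit.
Unset Printing Implicit Defensive.

Local Open Scope classical_set_scope.
Local Open Scope ring_scope.

(* [A] is meant to be open; values of [f] outside [A] are irrelevant. *)
Fixpoint Ck (R : realType) (m k : nat) (A : set 'rV[R]_m)
    (f : 'rV[R]_m -> R) : Prop :=
  (forall x, A x -> {for x, continuous f}) /\
  match k with
  | 0 => True
  | k'.+1 => forall i : 'I_m,
      (forall x, A x -> derivable f x (delta_mx 0 i)) /\
      Ck k' A (fun x => 'D_(delta_mx 0 i) f x)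
  end.

Definition smooth_on (R : realType) (m : nat) (A : set 'rV[R]_m)
    (f : 'rV[R]_m -> R) : Prop :=
  forall k, Ck k A f.

Definition smoothv_on (R : realType) (m k : nat) (A : set 'rV[R]_m)
    (f : 'rV[R]_m -> 'rV[R]_k) : Prop :=
  forall j : 'I_k, smooth_on A (fun x => f x 0 j).

(* The inverse [cinv] is total, but only its restriction to the image of the
   chart domain is meaningful. *)
Record chart (R : realType) (T : topologicalType) (m : nat) := Chart {
  cmap :> T -> 'rV[R]_m;
  cdom : set T;
  cinv : 'rV[R]_m -> T;
  open_cdom : open cdom;
  open_cimg : open (cmap @` cdom);
  cmapK : forall p, cdom p -> cinv (cmap p) = p;
  cmap_cont : forall p, cdom p -> {for p, continuous cmap};
  cinv_cont : forall x, (cmap @` cdom) x -> {for x, continuous cinv} }.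

Definition smooth_transition (R : realType) (T : topologicalType) (m : nat)
    (c d : chart R T m) : Prop :=
  smoothv_on (c @` (cdom c `&` cdom d)) (d \o cinv c).

(* Hausdorff, second countable, without boundary, with a maximal atlas.
   [chart_at] selects a preferred chart around each point (see the tangent
   space below); it carries no additional information. *)
Record manifold (R : realType) (m : nat) := Manifold {
  mspace :> topologicalType;
  mhausdorff : hausdorff_space mspace;
  msecond_countable : @second_countable mspace;
  atlas : set (chart R mspace m);
  atlas_compat : forall c d, atlas c -> atlas d -> smooth_transition c d;
  atlas_max : forall c,
    (forall d, atlas d -> smooth_transition c d /\ smooth_transition d c) ->
    atlas c;
  chart_at : mspace -> chart R mspace m;
  chart_at_atlas : forall p, atlas (chart_at p);
  chart_at_dom : forall p, cdom (chart_at p) p }.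

Arguments atlas {R m} _ _.

Definition smooth_fun (R : realType) (m : nat) (M : manifold R m)
    (U : set M) (f : M -> R) : Prop :=
  forall c, atlas M c -> smooth_on (c @` (U `&` cdom c)) (f \o cinv c).

Definition smooth_map (R : realType) (m k : nat) (M : manifold R m)
    (N : manifold R k) (F : M -> N) : Prop :=
  continuous F /\
  forall c d, atlas M c -> atlas N d ->
    smoothv_on (c @` (cdom c `&` F @^-1` cdom d)) (d \o F \o cinv c).

(* T_pM is modelled on 'rV[R]_m: a row vector [v] at [p] stands for the tangent
   vector whose components in the preferred chart [chart_at p] are [v].
   [dvec F p v] is the derivative at [p] in the direction [v] of a function on
   M with values in a normed space. Thus [dvec f p v] is v(f) for a scalar f,
   and [dvec c p v] is the row of components of [v] in an arbitrary chart [c]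
   around [p]. *)
Definition dvec (R : realType) (m : nat) (M : manifold R m)
    (V : normedModType R) (F : M -> V) (p : M) (v : 'rV[R]_m) : V :=
  'D_v (F \o cinv (chart_at p)) (chart_at p p).

(* The tangent map T_pM -> T_(F p)N; the result is in the chart chart_at (F p). *)
Definition tmap (R : realType) (m k : nat) (M : manifold R m)
    (N : manifold R k) (F : M -> N) (p : M) (v : 'rV[R]_m) : 'rV[R]_k :=
  dvec (chart_at (F p) \o F) p v.

Definition immersion (R : realType) (m k : nat) (M : manifold R m)
    (N : manifold R k) (F : M -> N) : Prop :=
  smooth_map F /\ forall p, injective (tmap F p).

(* An element of Gamma(TM|_U) is represented by a field on all of M that is
   smooth on U; its values outside U are irrelevant. *)
Definition vfield (R : realType) (m : nat) (M : manifold R m) : Type :=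
  M -> 'rV[R]_m.

Definition smooth_vf (R : realType) (m : nat) (M : manifold R m)
    (U : set M) (X : vfield M) : Prop :=
  forall c, atlas M c -> forall j : 'I_m,
    smooth_fun (U `&` cdom c) (fun p => dvec c p (X p) 0 j).

(* The coordinate field d/dx^i of the chart [c], on [cdom c]. *)
Definition coord_vf (R : realType) (m : nat) (M : manifold R m)
    (c : chart R M m) (i : 'I_m) : vfield M :=
  fun p => 'D_(delta_mx 0 i) (chart_at p \o cinv c) (c p).

(* [X,Y]^i = X(Y^i) - Y(X^i), computed in the preferred chart at p. *)
Definition lie (R : realType) (m : nat) (M : manifold R m)
    (X Y : vfield M) : vfield M :=
  fun p => dvec (fun q => dvec (chart_at p) q (Y q)) p (X p)
         - dvec (fun q => dvec (chart_at p) q (X q)) p (Y p).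

Definition bil (R : realType) (m : nat) (G : 'M[R]_m) (u v : 'rV[R]_m) : R :=
  (u *m G *m v^T) 0 0.

(* [g p] is the Gram matrix of a bilinear form on T_pM, [theta p] the column of
   a linear form on T_pM. *)
Definition tensor02 (R : realType) (m : nat) (M : manifold R m) : Type :=
  M -> 'M[R]_m.

Definition oneform (R : realType) (m : nat) (M : manifold R m) : Type :=
  M -> 'cV[R]_m.

Definition form_app (R : realType) (m : nat) (t : 'cV[R]_m) (v : 'rV[R]_m) : R :=
  (v *m t) 0 0.

Definition smooth_tensor02 (R : realType) (m : nat) (M : manifold R m)
    (g : tensor02 M) : Prop :=
  forall (U : set M) (X Y : vfield M), open U ->
    smooth_vf U X -> smooth_vf U Y ->
    smooth_fun U (fun p => bil (g p) (X p) (Y p)).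

Definition smooth_oneform (R : realType) (m : nat) (M : manifold R m)
    (theta : oneform M) : Prop :=
  forall (U : set M) (X : vfield M), open U -> smooth_vf U X ->
    smooth_fun U (fun p => form_app (theta p) (X p)).

(* The index of a symmetric bilinear form: the largest dimension of a subspace
   on which it is negative definite. A k-dimensional subspace is the row space
   of a row-free W with k rows. *)
Definition neg_def_on (R : realType) (m k : nat) (G : 'M[R]_m)
    (W : 'M[R]_(k, m)) : Prop :=
  forall a : 'rV[R]_k, a != 0 -> bil G (a *m W) (a *m W) < 0.

Definition has_index (R : realType) (m : nat) (G : 'M[R]_m) (nu : nat) : Prop :=
  (exists W : 'M[R]_(nu, m), row_free W /\ neg_def_on G W) /\
  (forall (k : nat) (W : 'M[R]_(k, m)),
     row_free W -> neg_def_on G W -> (k <= nu)%N).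

Definition pseudo_riemannian (R : realType) (m : nat) (M : manifold R m)
    (g : tensor02 M) (nu : nat) : Prop :=
  smooth_tensor02 g /\
  forall p, [/\ (g p)^T = g p, g p \in unitmx & has_index (g p) nu].

Definition pullback (R : realType) (m k : nat) (M : manifold R m)
    (N : manifold R k) (F : M -> N) (h : tensor02 N) : tensor02 M :=
  fun p => \matrix_(i, j)
    bil (h (F p)) (tmap F p (delta_mx 0 i)) (tmap F p (delta_mx 0 j)).

(* A connection as a Koszul operator on the sheaf of smooth vector fields: it
   acts on local sections over every open set, compatibly with restriction
   ([nabla_local]). Nothing is required where the arguments are not smooth. *)
Record connection (R : realType) (m : nat) (M : manifold R m) := Connection {
  nabla :> vfield M -> vfield M -> vfield M;
  nabla_smooth : forall (U : set M) X Y, open U ->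
    smooth_vf U X -> smooth_vf U Y -> smooth_vf U (nabla X Y);
  nabla_local : forall (U : set M) X X' Y Y', open U ->
    smooth_vf U X -> smooth_vf U Y ->
    (forall p, U p -> X p = X' p) -> (forall p, U p -> Y p = Y' p) ->
    forall p, U p -> nabla X Y p = nabla X' Y' p;
  nablaDl : forall (U : set M) X X' Y, open U ->
    smooth_vf U X -> smooth_vf U X' -> smooth_vf U Y ->
    forall p, U p ->
      nabla (fun q => X q + X' q) Y p = nabla X Y p + nabla X' Y p;
  nablaZl : forall (U : set M) (f : M -> R) X Y, open U ->
    smooth_fun U f -> smooth_vf U X -> smooth_vf U Y ->
    forall p, U p -> nabla (fun q => f q *: X q) Y p = f p *: nabla X Y p;
  nablaDr : forall (U : set M) X Y Y', open U ->
    smooth_vf U X -> smooth_vf U Y -> smooth_vf U Y' ->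
    forall p, U p ->
      nabla X (fun q => Y q + Y' q) p = nabla X Y p + nabla X Y' p;
  nabla_leibniz : forall (U : set M) (f : M -> R) X Y, open U ->
    smooth_fun U f -> smooth_vf U X -> smooth_vf U Y ->
    forall p, U p ->
      nabla X (fun q => f q *: Y q) p
      = (dvec f p (X p) : R) *: Y p + f p *: nabla X Y p }.

Definition torsion_free (R : realType) (m : nat) (M : manifold R m)
    (D : connection M) : Prop :=
  forall (U : set M) (X Y : vfield M), open U ->
    smooth_vf U X -> smooth_vf U Y ->
    forall p, U p -> D X Y p - D Y X p = lie X Y p.

(* (D_X g)(Y, Z) *)
Definition cov_tensor (R : realType) (m : nat) (M : manifold R m)
    (D : connection M) (g : tensor02 M) (X Y Z : vfield M) (p : M) : R :=
  (dvec (fun q => bil (g q) (Y q) (Z q) : R) p (X p) : R)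
  - bil (g p) (D X Y p) (Z p) - bil (g p) (Y p) (D X Z p).

Definition conformal_with (R : realType) (m : nat) (M : manifold R m)
    (D : connection M) (g : tensor02 M) (theta : oneform M) : Prop :=
  forall (U : set M) (X Y Z : vfield M), open U ->
    smooth_vf U X -> smooth_vf U Y -> smooth_vf U Z ->
    forall p, U p ->
      cov_tensor D g X Y Z p
      = form_app (theta p) (X p) * bil (g p) (Y p) (Z p).

Definition weyl_connection (R : realType) (m : nat) (M : manifold R m)
    (g : tensor02 M) (D : connection M) : Prop :=
  torsion_free D /\
  exists theta : oneform M, smooth_oneform theta /\ conformal_with D g theta.

Definition levi_civita (R : realType) (m : nat) (M : manifold R m)
    (g : tensor02 M) (D : connection M) : Prop :=
  torsion_free D /\
  forall (U : set M) (X Y Z : vfield M), open U ->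
    smooth_vf U X -> smooth_vf U Y -> smooth_vf U Z ->
    forall p, U p -> cov_tensor D g X Y Z p = 0.

(* Dbar_X Y in T_(F p)N for X, Y tangent to M (identified with their images
   under F): with y^a the coordinates of N around F p, Gamma^a_bd the
   components of Dbar_(d/dy^b) d/dy^d there, and X^b, Y^d the components of
   F_* X, F_* Y, its components are X(Y^a) + Gamma^a_bd X^b Y^d. *)
Definition nabla_along (R : realType) (m k : nat) (M : manifold R m)
    (N : manifold R k) (F : M -> N) (Dbar : connection N)
    (X Y : vfield M) (p : M) : 'rV[R]_k :=
  let c := chart_at (F p) in
  dvec (fun q => dvec (c \o F) q (Y q)) p (X p)
  + \sum_(b < k) \sum_(d < k)
      (tmap F p (X p) 0 b * tmap F p (Y p) 0 d)
        *: Dbar (coord_vf c b) (coord_vf c d) (F p).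

(* An immersed submanifold of codimension 1, given by its inclusion map,
   whose induced tensor has constant rank n. *)
Definition lightlike_hypersurface (R : realType) (n : nat)
    (M : manifold R n.+1) (N : manifold R n.+2) (gbar : tensor02 N)
    (iota : M -> N) : Prop :=
  [/\ injective iota, immersion iota
    & forall p, \rank (pullback iota gbar p) = n].

Definition normal_at (R : realType) (m k : nat) (M : manifold R m)
    (N : manifold R k) (F : M -> N) (gbar : tensor02 N) (p : M)
    (w : 'rV[R]_k) : Prop :=
  forall v : 'rV[R]_m, bil (gbar (F p)) w (tmap F p v) = 0.

(* As the normal bundle of a lightlike hypersurface is contained in TM, its
   sections are represented by vector fields xi on M with F_* xi normal. *)
Definition normal_section (R : realType) (m k : nat) (M : manifold R m)
    (N : manifold R k) (F : M -> N) (gbar : tensor02 N) (U : set M)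
    (xi : vfield M) : Prop :=
  smooth_vf U xi /\
  forall p, U p -> xi p != 0 /\ normal_at F gbar p (tmap F p (xi p)).

Definition second_form (R : realType) (m k : nat) (M : manifold R m)
    (N : manifold R k) (F : M -> N) (gbar : tensor02 N) (Dbar : connection N)
    (xi X Y : vfield M) (p : M) : R :=
  bil (gbar (F p)) (nabla_along F Dbar X Y p) (tmap F p (xi p)).

Definition totally_umbilical (R : realType) (m k : nat) (M : manifold R m)
    (N : manifold R k) (F : M -> N) (gbar : tensor02 N)
    (Dbar : connection N) : Prop :=
  forall c, atlas M c -> forall xi, normal_section F gbar (cdom c) xi ->
    exists lambda : M -> R, smooth_fun (cdom c) lambda /\
      forall X Y, smooth_vf (cdom c) X -> smooth_vf (cdom c) Y ->
        forall p, cdom c p ->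
          second_form F gbar Dbar xi X Y p
          = lambda p * bil (pullback F gbar p) (X p) (Y p).

(* Main.v *)
From HB Require Import structures.
Require Import Defs.
From mathcomp Require Import all_boot all_order all_algebra.
From mathcomp Require Import all_classical all_reals all_analysis.
From mathcomp Require Import ring lra.
Import Order.TTheory GRing.Theory Num.Theory.
Import numFieldNormedType.Exports.

(** Let g be the degenerate metric induced on the hypersurface M and B its second
    fundamental form with respect to a normal field xi, which spans the kernel
    of g. Koszul's expression K(X, Y, Z), formed with the derivatives of g and
    brackets, makes sense for any symmetric tensor. The ambient connection is
    compatible with the ambient metric ([metric_along]) and torsion-free
    ([torsion_along]) along the immersion, hence its tangential part is computed
    by K ([koszul_along]); taking Z = xi,

      K(X, Y, xi) = 2 B(X, Y).

    If M carries a torsion-free connection with nabla g = theta (x) g, then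
    K(X, Y, Z) equals 2 g(nabla_X Y, Z) plus terms in theta ([koszul_weyl]). As xi
    is in the kernel of g, only - theta(xi) g(X, Y) survives for Z = xi, and
    B = lambda g with lambda = - theta(xi) / 2 ([weyl_umbilical]).

    Conversely, let B = lambda g. In a chart, a torsion-free connection with
    nabla g = theta (x) g is a solution of linear systems whose matrix is the
    degenerate matrix G of g. They are solvable when their right-hand sides are
    orthogonal to xi, and the formula for K(X, Y, xi) turns this condition into
    theta(xi) = - 2 lambda, which can be met. Smoothness of the solution is
    obtained by replacing G by an invertible matrix G + E_aa ([completed_mx_kernel],
    [completed_mx_solve]). This gives a Weyl connection near every point
    ([umbilical_local_weyl]).

    The pairs (nabla, theta) form an affine space, so that local solutions can be
    glued. Rather than with a partition of unity subordinate to a locally finite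
    cover, this is done with structures that behave like b times a Weyl connection
    for a weight function b ([weighted_weyl_at]): a countable family of them, whose
    weights are equal to 1 on open sets that cover M, is summed by a recursion
    that is locally stationary ([weighted_weyl_glue]).

    The calculus behind this is developed first: functions with continuous
    partial derivatives are differentiable ([C1_differentiable]), smooth germs
    are stable under the usual operations, mixed derivatives commute ([schwarz]),
    and bump functions exist ([bump_exists], [bump_on_manifold]). *)

Set Implicit Arguments.
Unset Strict Implicit.
Unset Printing Implicit Defensive.

Local Open Scope classical_set_scope.
Local Open Scope ring_scope.

(** * Neighbourhoods *)

Lemma near_all (T : topologicalType) (I : finType) (x : T) (P : I -> T -> Prop) :
  (forall i, \forall y \near x, P i y) -> \forall y \near x, forall i, P i y.
Proof. by move=> H; exact: filter_forall H. Qed.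

Lemma near_everywhere (T : topologicalType) (x : T) (P : T -> Prop) :
  (forall y, P y) -> \forall y \near x, P y.
Proof. by move=> H; apply: nearW. Qed.

Lemma near_and (T : topologicalType) (x : T) (P Q : T -> Prop) :
  (\forall y \near x, P y) -> (\forall y \near x, Q y) ->
  \forall y \near x, P y /\ Q y.
Proof. by move=> p q; exact: filterI p q. Qed.

Lemma continuous_near_eq (T U : topologicalType) (f g : T -> U) x :
  (\forall y \near x, f y = g y) -> {for x, continuous f} -> {for x, continuous g}.
Proof.
move=> fg cf; rewrite /prop_for /continuous_at -(nbhs_singleton fg).
exact: (cvg_trans (near_eq_cvg fg) cf).
Qed.

Lemma continuous_near (T U : topologicalType) (F : T -> U) p (P : U -> Prop) :
  {for p, continuous F} -> (\forall y \near F p, P y) -> \forall q \near p, P (F q).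
Proof. by move=> cF PH; exact: (cF _ PH). Qed.

Lemma near_open (T : topologicalType) (x : T) (P : T -> Prop) :
  (\forall y \near x, P y) ->
  exists U : set T, [/\ open U, U x & forall y, U y -> P y].
Proof. by move=> H; have : nbhs x P := H; rewrite nbhsE => -[U [oU Ux] sU]; exists U. Qed.

(** * Total differentiability *)

Section MeanValue.
Context {R : realType} {m : nat}.
Implicit Types (f : 'rV[R]_m -> R) (x y v : 'rV[R]_m).

Lemma is_derive_line f x v (t : R) : derivable f (t *: v + x) v ->
  is_derive t 1 (fun s : R => f (s *: v + x)) ('D_v f (t *: v + x)).
Proof.
have E : (fun h : R =>
     h^-1 *: (((fun s => f (s *: v + x)) \o shift t) (h *: 1) - f (t *: v + x)))
   = (fun h => h^-1 *: ((f \o shift (t *: v + x)) (h *: v) - f (t *: v + x))).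
  by apply: funext => h /=; rewrite [h *: 1]mulr1 scalerDl addrA.
move=> d; split; first by rewrite /derivable E.
by rewrite /derive E.
Qed.

Lemma mvt_line f x v (a : R) :
  (forall t : R, `|t| <= `|a| -> derivable f (t *: v + x) v) ->
  exists2 c : R, `|c| <= `|a| &
    f (a *: v + x) - f x = a * 'D_v f (c *: v + x).
Proof.
move=> d; pose g s := f (s *: v + x).
have dg (t : R) : `|t| <= `|a| -> is_derive (t : R) 1 (g : R -> R) ('D_v f (t *: v + x)).
  by move=> /d; exact: is_derive_line.
have cg (u w : R) : (forall t, t \in `[u, w] -> `|t| <= `|a|) ->
    {within `[u, w], continuous g}.
  move=> uw; apply: derivable_within_continuous => t /uw /dg.
  by move=> [].
have g0 : g 0 = f x by rewrite /g scale0r add0r.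
have [a0|a0] := leP 0 a.
- have I (t : R) : t \in `[0, a] -> `|t| <= `|a|.
    by rewrite in_itv /= => /andP[t0 ta]; rewrite !ger0_norm.
  have [c ca E] : exists2 c, c \in `[0, a]%R & g a - g 0 = 'D_v f (c *: v + x) * (a - 0).
    apply: MVT_segment (cg _ _ I) => // t t0a; apply/dg/I.
    exact: subset_itv_oo_cc t0a.
  by exists c; [exact: I|rewrite -g0 E subr0 mulrC].
- have I (t : R) : t \in `[a, 0] -> `|t| <= `|a|.
    by rewrite in_itv /= => /andP[ta t0]; rewrite !ler0_norm ?lerN2// ltW.
  have [c ca E] : exists2 c, c \in `[a, 0]%R & g 0 - g a = 'D_v f (c *: v + x) * (0 - a).
    apply: MVT_segment (cg _ _ I) => // [|t t0a]; first exact: ltW.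
    apply/dg/I; exact: subset_itv_oo_cc t0a.
  exists c; first exact: I.
  by rewrite -g0 -opprB E sub0r mulrN opprK mulrC.
Qed.

End MeanValue.

Section TotalDerivative.
Context {R : realType} {m : nat}.
Implicit Types (f : 'rV[R]_m -> R) (x y v : 'rV[R]_m).

Lemma norm_coord_le (n : nat) (v : 'rV[R]_n) i : `|v 0 i| <= `|v|.
Proof.
rewrite [leRHS]/Num.Def.normr/= mx_normrE.
exact: (le_bigmax _ (fun ij : 'I_1 * 'I_n => `|v ij.1 ij.2|) (0, i)).
Qed.

Lemma norm_le_coord (n : nat) (v : 'rV[R]_n) (e : R) : 0 <= e ->
  (forall i, `|v 0 i| <= e) -> `|v| <= e.
Proof.
move=> e0 H; rewrite [leLHS]/Num.Def.normr/= mx_normrE bigmax_le// => -[i j] _.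
by rewrite /= ord1.
Qed.

Let gradient f x v := \sum_i v 0 i * 'D_(delta_mx 0 i) f x.

(** The increment from [x] to [x + h] is the sum of the increments along the
    edges of a path that changes one coordinate at a time; the mean value
    theorem on each edge and the continuity of the partial derivatives bound
    the error. *)
Lemma C1_differentiable f x :
  (forall i, \forall y \near x, derivable f y (delta_mx 0 i)) ->
  (forall i, {for x, continuous (fun y => 'D_(delta_mx 0 i) f y)}) ->
  differentiable f x.
Proof.
move=> dnear cont.
pose L : 'rV[R]_m -> R := gradient f x.
have linL : linear L.
  move=> a u v; rewrite /L /gradient scaler_sumr -big_split/=; apply: eq_bigr => i _.
  by rewrite !mxE mulrDl /GRing.scale/= mulrA.
pose Ll : {linear 'rV[R]_m -> R} := HB.pack L (GRing.isLinear.Build _ _ _ _ L linL).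
have cL : continuous L.
  move=> v; have -> : L = \sum_(i < m) (fun v : 'rV[R]_m => v 0 i * 'D_(delta_mx 0 i) f x).
    by apply: funext => w; rewrite fct_sumE.
  apply: differentiable_continuous; apply: differentiable_sum => i.
  apply: differentiableM => //; exact: differentiable_coord.
have key : forall e : R, 0 < e ->
    \forall h \near (0 : 'rV[R]_m), `|f (h + x) - f x - L h| <= e * `|h|.
  move=> e e0; pose e' := e / m.+1%:R.
  have e'0 : 0 < e' by rewrite divr_gt0.
  have : \forall y \near x, forall i : 'I_m, derivable f y (delta_mx 0 i) /\
      `|'D_(delta_mx 0 i) f x - 'D_(delta_mx 0 i) f y| <= e'.
    have H (i : 'I_m) : \forall y \near x, derivable f y (delta_mx 0 i) /\
        `|'D_(delta_mx 0 i) f x - 'D_(delta_mx 0 i) f y| <= e'.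
      apply: filterI; first exact: dnear.
      by have /cvgrPdist_le := cont i; apply.
    exact: filter_forall H.
  move=> /nbhs_ballP [d /= d0 dH].
  near=> h.
  have hd : `|h| < d by near: h; exact: (@nbhs0_lt _ 'rV[R]_m).
  (* w k agrees with h in the first k coordinates: the vertices of the path *)
  pose w k : 'rV[R]_m := \row_i (if (i < k)%N then h 0 i else 0).
  have w0 : w 0%N = 0 by apply/rowP => i; rewrite !mxE.
  have wm : w m = h by apply/rowP => i; rewrite !mxE ltn_ord.
  have wS (i : 'I_m) : w i.+1 = h 0 i *: delta_mx 0 i + w i.
    apply/rowP => j; rewrite !mxE eqxx/= ltnS leq_eqVlt -val_eqE /= eq_sym.
    case: eqVneq => [ij|ij] /=; last by rewrite mulr0 add0r.
    have -> : j = i by apply: val_inj.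
    by rewrite ltnn mulr1 addr0.
  have -> : f (h + x) - f x = \sum_(i < m) (f (w i.+1 + x) - f (w i + x)).
    rewrite -(big_mkord xpredT (fun i => f (w i.+1 + x) - f (w i + x))).
    by rewrite telescope_sumr// w0 wm add0r.
  rewrite /L /gradient -sumrB.
  have T (i : 'I_m) : `|f (w i.+1 + x) - f (w i + x) - h 0 i * 'D_(delta_mx 0 i) f x| <=
    e' * `|h|.
    have B (t : R) : `|t| <= `|h 0 i| -> ball x d (t *: delta_mx 0 i + (w i + x)).
      move=> th; rewrite -ball_normE /= addrA -normrN opprB addrK.
      apply: le_lt_trans hd; apply: norm_le_coord => // j.
      rewrite !mxE eqxx/=; case: eqVneq => [->|ji].
        by rewrite ltnn addr0 mulr1 (le_trans th)// norm_coord_le.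
      rewrite mulr0 add0r; case: ifP => _; rewrite ?normr0// norm_coord_le//.
    have [|c ch E] := @mvt_line R m f (w i + x) (delta_mx 0 i) (h 0 i).
      by move=> t /B /dH /(_ i) [].
    rewrite wS -(addrA _ (w i) x) E; rewrite -mulrBr normrM mulrC ler_pM ?norm_coord_le//.
    rewrite distrC; by have /dH /(_ i) [] := B c ch.
  apply: le_trans (ler_norm_sum _ _ _) _.
  apply: le_trans (ler_sum _ (fun i _ => T i)) _.
  rewrite sumr_const card_ord -mulr_natr mulrAC ler_wpM2r//.
  by rewrite /e' mulrAC ler_pdivrMr// ler_wpM2l ?(ltW e0)// ler_nat.
have keyo : f \o shift x = cst (f x) + L +o_ (0 : 'rV[R]_m) id.
  apply/eqaddoP => e e0; near=> h.
  have -> : (f \o shift x - (cst (f x) + L)) h = f (h + x) - f x - L h.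
    by rewrite /= opprD addrA.
  by near: h; exact: key.
have dE := @diff_unique _ _ _ f Ll x cL keyo.
apply/diff_locallyP; split; first by rewrite dE.
by rewrite dE.
Unshelve. all: by end_near. Qed.

Lemma derive_sum_partials f x v : differentiable f x ->
  'D_v f x = \sum_i v 0 i * 'D_(delta_mx 0 i) f x.
Proof.
move=> df; rewrite deriveE// [in LHS](row_sum_delta v) linear_sum.
by apply: eq_bigr => i _; rewrite linearZ/= deriveE.
Qed.

End TotalDerivative.

(** * Germs of smooth functions *)

(** The conditions of [Ck] in a neighbourhood of a point: closure under the
    operations then needs no bookkeeping of domains. *)
Fixpoint Cgerm (R : realType) (m k : nat) (x : 'rV[R]_m) (f : 'rV[R]_m -> R) : Prop :=
  (\forall y \near x, {for y, continuous f}) /\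
  match k with
  | 0 => True
  | k'.+1 => forall i : 'I_m,
      (\forall y \near x, derivable f y (delta_mx 0 i)) /\
      Cgerm k' x (fun y => 'D_(delta_mx 0 i) f y)
  end.

(** The neighbourhood may shrink as [k] grows. On an open set this makes no
    difference, see [smooth_onP]. *)
Definition smooth_germ (R : realType) (m : nat) (x : 'rV[R]_m) (f : 'rV[R]_m -> R) :=
  forall k, Cgerm k x f.

Section Germs.
Context {R : realType}.
Implicit Types (m n k : nat).

Lemma Cgerm_continuous m k x (f : 'rV[R]_m -> R) : Cgerm k x f ->
  \forall y \near x, {for y, continuous f}.
Proof. by case: k => [|k] []. Qed.

Lemma Cgerm_near m k x (f : 'rV[R]_m -> R) : Cgerm k x f ->
  \forall y \near x, Cgerm k y f.
Proof.
elim: k f => [|k IH] f /= [c d].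
  by have := near_join c; apply: filterS.
have : \forall y \near x, forall i : 'I_m, (\forall z \near y, derivable f z (delta_mx 0 i)) /\
      Cgerm k y (fun y => 'D_(delta_mx 0 i) f y).
  apply: near_all => i; have [di /IH Ci] := d i.
  by apply: filterI Ci; exact: near_join di.
have := near_join c; apply: filterS2 => y cy dy; by split.
Qed.

Lemma Cgerm_ext m k x (f g : 'rV[R]_m -> R) : (\forall y \near x, f y = g y) ->
  Cgerm k x f -> Cgerm k x g.
Proof.
elim: k f g => [|k IH] f g fg [c d].
  split=> //; move: c (near_join fg); apply: filterS2 => y cy fgy.
  exact: continuous_near_eq cy.
split.
  move: c (near_join fg); apply: filterS2 => y cy fgy.
  exact: continuous_near_eq cy.
move=> i; have [di Ci] := d i; split.
  move: di (near_join fg); apply: filterS2 => y dy fgy.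
  exact: near_eq_derivable dy.
apply: IH Ci; have := near_join fg; apply: filterS => y; exact: near_eq_derive.
Qed.

Lemma CgermW m k x (f : 'rV[R]_m -> R) : Cgerm k.+1 x f -> Cgerm k x f.
Proof.
elim: k f => [|k IH] f [c d]; first by split.
by split=> // i; have [di /IH Ci] := d i.
Qed.

Lemma Cgerm_le m j k x (f : 'rV[R]_m -> R) : (j <= k)%N -> Cgerm k x f -> Cgerm j x f.
Proof.
by move=> /subnK <-; elim: (k - j)%N => [//|d IH] /CgermW.
Qed.

Lemma Cgerm_differentiable m k x (f : 'rV[R]_m -> R) : Cgerm k.+1 x f ->
  differentiable f x.
Proof.
move=> /(@Cgerm_le m 1 k.+1 x f isT) [_ d].
apply: C1_differentiable => i; have [di Ci] := d i => //.
by case: Ci => /nbhs_singleton.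
Qed.

Lemma Cgerm_partial m k x (f : 'rV[R]_m -> R) i : Cgerm k.+1 x f ->
  Cgerm k x (fun y => 'D_(delta_mx 0 i) f y).
Proof. by move=> [_ /(_ i)[]]. Qed.

Lemma CgermS m k x (f : 'rV[R]_m -> R) :
  (\forall y \near x, differentiable f y) ->
  (forall i, Cgerm k x (fun y => 'D_(delta_mx 0 i) f y)) -> Cgerm k.+1 x f.
Proof.
move=> df Cf; split.
  by apply: filterS df => y; exact: differentiable_continuous.
move=> i; split=> //; apply: filterS df => y; exact: diff_derivable.
Qed.

Lemma Cgerm_near_differentiable m k x (f : 'rV[R]_m -> R) : Cgerm k.+1 x f ->
  \forall y \near x, differentiable f y.
Proof. by move=> /Cgerm_near; apply: filterS => y; exact: Cgerm_differentiable. Qed.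

Lemma Cgerm_cst m k x (a : R) : Cgerm k x (cst a : 'rV[R]_m -> R).
Proof.
elim: k a => [|k IH] a.
  split=> //; apply: near_everywhere => y; exact: cst_continuous.
apply: CgermS; first by apply: near_everywhere => y; exact: differentiable_cst.
move=> i; apply: (Cgerm_ext _ (IH 0)); apply: near_everywhere => y /=.
by rewrite derive_cst.
Qed.

Lemma derive_coord m (x v : 'rV[R]_m) j : 'D_v (fun y : 'rV[R]_m => y 0 j) x = v 0 j.
Proof.
have lin : linear (fun y : 'rV[R]_m => y 0 j) by move=> a u w; rewrite !mxE.
pose L : {linear 'rV[R]_m -> R} := HB.pack (fun y : 'rV[R]_m => y 0 j)
  (GRing.isLinear.Build _ _ _ _ _ lin).
have cL : continuous L by exact: coord_continuous.
rewrite deriveE; last exact: differentiable_coord.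
by have -> := @diff_lin _ _ _ L x cL.
Qed.

Lemma Cgerm_coord m k x j : Cgerm k x (fun y : 'rV[R]_m => y 0 j).
Proof.
case: k => [|k].
  split=> //; apply: near_everywhere => y; exact: coord_continuous.
apply: CgermS; first by apply: near_everywhere => y; exact: differentiable_coord.
move=> i; apply: (Cgerm_ext _ (Cgerm_cst _ _ ((delta_mx 0 i : 'rV[R]_m) 0 j))).
by apply: near_everywhere => y /=; rewrite derive_coord.
Qed.

Lemma CgermD m k x (f g : 'rV[R]_m -> R) : Cgerm k x f -> Cgerm k x g ->
  Cgerm k x (fun y => f y + g y).
Proof.
elim: k f g => [|k IH] f g Cf Cg.
  split=> //; move: (Cgerm_continuous Cf) (Cgerm_continuous Cg).
  apply: filterS2 => y cf cg; exact: continuousD.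
have df := Cgerm_near_differentiable Cf; have dg := Cgerm_near_differentiable Cg.
apply: CgermS.
  by move: df dg; apply: filterS2 => y; exact: differentiableD.
move=> i; apply: Cgerm_ext (IH _ _ (Cgerm_partial i Cf) (Cgerm_partial i Cg)).
move: df dg; apply: filterS2 => y dfy dgy.
by rewrite -deriveD//; exact: diff_derivable.
Qed.

Lemma CgermM m k x (f g : 'rV[R]_m -> R) : Cgerm k x f -> Cgerm k x g ->
  Cgerm k x (fun y => f y * g y).
Proof.
elim: k f g => [|k IH] f g Cf Cg.
  split=> //; move: (Cgerm_continuous Cf) (Cgerm_continuous Cg).
  apply: filterS2 => y cf cg; exact: continuousM.
have df := Cgerm_near_differentiable Cf; have dg := Cgerm_near_differentiable Cg.
apply: CgermS.
  by move: df dg; apply: filterS2 => y; exact: differentiableM.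
move=> i; apply: Cgerm_ext (CgermD (IH _ _ (CgermW Cf) (Cgerm_partial i Cg))
  (IH _ _ (CgermW Cg) (Cgerm_partial i Cf))).
move: df dg; apply: filterS2 => y dfy dgy.
by rewrite -[RHS]/('D_(delta_mx 0 i) (f * g) y) deriveM//; exact: diff_derivable.
Qed.

Lemma Cgerm_sum m k x (I : Type) (r : seq I) (P : pred I) (f : I -> 'rV[R]_m -> R) :
  (forall i, P i -> Cgerm k x (f i)) ->
  Cgerm k x (fun y => \sum_(i <- r | P i) f i y).
Proof.
move=> Cf; elim: r => [|i r IH].
  by apply: Cgerm_ext (Cgerm_cst _ _ 0); apply: near_everywhere => y; rewrite big_nil.
have [Pi|Pi] := boolP (P i).
  by apply: Cgerm_ext (CgermD (Cf i Pi) IH); apply: near_everywhere => y; rewrite big_cons Pi.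
by apply: Cgerm_ext IH; apply: near_everywhere => y; rewrite big_cons (negbTE Pi).
Qed.

Lemma CgermN m k x (f : 'rV[R]_m -> R) : Cgerm k x f -> Cgerm k x (fun y => - f y).
Proof.
move=> Cf; apply: Cgerm_ext (CgermM (Cgerm_cst k x (-1)) Cf).
by apply: near_everywhere => y /=; rewrite mulN1r.
Qed.

Lemma CgermV m k x (f : 'rV[R]_m -> R) : f x != 0 -> Cgerm k x f ->
  Cgerm k x (fun y => (f y)^-1).
Proof.
move=> fx0.
have nf0 : Cgerm k x f -> \forall y \near x, f y != 0.
  move=> /Cgerm_continuous/nbhs_singleton cf.
  have n0 : nbhs (f x) [set z | z != 0].
    by apply: open_nbhs_nbhs; split=> //; exact: open_neq.
  exact: (cf _ n0).
elim: k nf0 => [|k IH] nf0 Cf.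
  split=> //; move: (Cgerm_continuous Cf) (nf0 Cf).
  apply: filterS2 => y cf f0; exact: continuousV.
have df := Cgerm_near_differentiable Cf.
have {IH}CV := IH (fun _ => nf0 Cf) (CgermW Cf).
apply: CgermS.
  by move: df (nf0 Cf); apply: filterS2 => y dfy f0; exact: differentiableV.
move=> i; apply: Cgerm_ext (CgermN (CgermM (CgermM CV CV) (Cgerm_partial i Cf))).
move: df (nf0 Cf); apply: filterS2 => y dfy f0.
rewrite deriveV//; last exact: diff_derivable.
by rewrite -exprVn expr2 scaleNr.
Qed.

Lemma differentiable_rV m n (g : 'rV[R]_m -> 'rV[R]_n) x :
  (forall j, differentiable (fun y => g y 0 j) x) -> differentiable g x.
Proof.
move=> dg; have -> : g = \sum_(j < n) (fun y => g y 0 j *: (delta_mx 0 j : 'rV[R]_n)).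
  by apply: funext => y; rewrite fct_sumE [LHS]row_sum_delta.
by apply: differentiable_sum => j; exact: differentiableZl.
Qed.

Lemma continuous_rV (T : topologicalType) n (g : T -> 'rV[R]_n) x :
  (forall j, {for x, continuous (fun y => g y 0 j)}) -> {for x, continuous g}.
Proof.
move=> cg A [P PA sPA].
have : \forall y \near x, forall j, P 0 j (g y 0 j).
  by apply: near_all => j; exact: (cg j _ (PA 0 j)).
rewrite near_simpl /=; apply: filterS => y Py; apply: sPA => i j; rewrite ord1; exact: Py.
Qed.

Lemma derive_rV m n (g : 'rV[R]_m -> 'rV[R]_n) x v j : differentiable g x ->
  ('D_v g x) 0 j = 'D_v (fun y => g y 0 j) x.
Proof. by move=> dg; rewrite derive_mx ?mxE//; exact: diff_derivable. Qed.

Lemma derive_comp m n (f : 'rV[R]_n -> R) (g : 'rV[R]_m -> 'rV[R]_n) x v :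
  differentiable g x -> differentiable f (g x) ->
  'D_v (f \o g) x = 'D_('D_v g x) f (g x).
Proof.
move=> dg df; rewrite deriveE; last exact: differentiable_comp.
by rewrite diff_comp//= -!deriveE.
Qed.

(** By the chain rule a partial derivative of [f \o g] is a sum of products of
    partial derivatives of [g] with partial derivatives of [f] composed with
    [g], to which the induction hypothesis on [k] applies. *)
Lemma Cgerm_comp m n k x (f : 'rV[R]_n -> R) (g : 'rV[R]_m -> 'rV[R]_n) :
  Cgerm k (g x) f -> (forall j, Cgerm k x (fun y => g y 0 j)) ->
  Cgerm k x (f \o g).
Proof.
move=> + Cg; have cg : \forall y \near x, {for y, continuous g}.
  have : \forall y \near x, forall j, {for y, continuous (fun y => g y 0 j)}.
    by apply: near_all => j; exact: Cgerm_continuous (Cg j).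
  by apply: filterS => y; exact: continuous_rV.
have pull (P : set 'rV[R]_n) : (\forall z \near g x, P z) -> \forall y \near x, P (g y).
  by move=> PH; exact: (nbhs_singleton cg _ PH).
elim: k f Cg => [|k IH] f Cg Cf.
  split=> //; move: cg (pull _ (Cgerm_continuous Cf)); apply: filterS2 => y cgy cfy.
  exact: continuous_comp.
have dg : \forall y \near x, differentiable g y.
  have : \forall y \near x, forall j, differentiable (fun y => g y 0 j) y.
    by apply: near_all => j; exact: Cgerm_near_differentiable (Cg j).
  by apply: filterS => y; exact: differentiable_rV.
have df := pull _ (Cgerm_near_differentiable Cf).
apply: CgermS.
  by move: dg df; apply: filterS2 => y; exact: differentiable_comp.
move=> i.
apply: (@Cgerm_ext _ _ _ (fun y => \sum_j 'D_(delta_mx 0 i) (fun y => g y 0 j) y *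
   ('D_(delta_mx 0 j) f (g y)))); last first.
  apply: Cgerm_sum => j _; apply: CgermM; first exact: Cgerm_partial.
  by apply: (IH (fun z => 'D_(delta_mx 0 j) f z)) => [l|]; [exact: CgermW|exact: Cgerm_partial].
move: dg df; apply: filterS2 => y dgy dfy.
rewrite derive_comp// derive_sum_partials//; apply: eq_bigr => j _.
by rewrite derive_rV.
Qed.

Lemma smooth_onP m (A : set 'rV[R]_m) f : open A ->
  smooth_on A f <-> forall x, A x -> smooth_germ x f.
Proof.
move=> oA; split=> [+ x Ax k|+ k].
  move=> /(_ k); elim: k f => [|k IH] f /= [c d].
    by split=> //; apply: filterS (open_nbhs_nbhs (conj oA Ax)).
  split; first by apply: filterS (open_nbhs_nbhs (conj oA Ax)).
  move=> i; have [di /IH] := d i; split=> //.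
  by apply: filterS (open_nbhs_nbhs (conj oA Ax)).
move=> H; have {}H x : A x -> Cgerm k x f by move=> /H.
elim: k f H => [|k IH] f H /=; split=> //.
- by move=> x /H [/nbhs_singleton].
- by move=> x /H [/nbhs_singleton].
- move=> i; split; first by move=> x /H [_ /(_ i) [/nbhs_singleton]].
  by apply: IH => x /H [_ /(_ i) []].
Qed.

End Germs.

(** * Symmetry of second derivatives *)

Section Schwarz.
Context {R : realType} {m : nat}.
Implicit Types (f : 'rV[R]_m -> R) (x y : 'rV[R]_m).

Lemma growth_rate_translate f (a x v : 'rV[R]_m) :
  (fun h : R => h^-1 *: (((fun z => f (z + a)) \o shift x) (h *: v) - f (x + a)))
  = (fun h => h^-1 *: ((f \o shift (x + a)) (h *: v) - f (x + a))).
Proof. by apply: funext => h /=; rewrite addrA. Qed.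

Lemma derive_translate f (a x v : 'rV[R]_m) : 'D_v (fun z => f (z + a)) x = 'D_v f (x + a).
Proof. by rewrite /derive growth_rate_translate. Qed.

Lemma derivable_translate f (a x v : 'rV[R]_m) :
  derivable f (x + a) v -> derivable (fun z => f (z + a)) x v.
Proof. by rewrite /derivable growth_rate_translate. Qed.

Lemma norm_delta_mx_le (a : R) i : `|a *: (delta_mx 0 i : 'rV[R]_m)| <= `|a|.
Proof.
apply: norm_le_coord => // j; rewrite !mxE eqxx/=.
by case: eqVneq; rewrite ?mulr1// mulr0 normr0.
Qed.

(** Two applications of the mean value theorem: first to the difference of [f]
    and its translate, in the direction i, then to the partial derivative, in the
    direction j. *)
Lemma second_difference f x (r s : R) i j : 0 < s -> s + s < r ->
  (forall y, ball x r y -> derivable f y (delta_mx 0 i) /\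
     derivable (fun z => 'D_(delta_mx 0 i) f z) y (delta_mx 0 j)) ->
  exists2 y, ball x r y &
  f (s *: delta_mx 0 i + x + s *: delta_mx 0 j) - f (s *: delta_mx 0 i + x)
    - (f (x + s *: delta_mx 0 j) - f x)
  = s * (s * 'D_(delta_mx 0 j) (fun z => 'D_(delta_mx 0 i) f z) y).
Proof.
move=> s0 sr df; set ei := delta_mx 0 i; set ej := delta_mx 0 j.
have B (c d : R) : `|c| <= `|s| -> `|d| <= `|s| -> ball x r (d *: ej + (c *: ei + x)).
  rewrite (gtr0_norm s0) => cs ds; rewrite -ball_normE /= addrA -normrN opprB addrK.
  apply: le_lt_trans sr; apply: le_trans (ler_normD _ _) _; apply: lerD.
    exact: le_trans (norm_delta_mx_le _ _) ds.
  exact: le_trans (norm_delta_mx_le _ _) cs.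
have B0 (c : R) : `|c| <= `|s| -> ball x r (c *: ei + x).
  by move=> cs; have := B c 0 cs; rewrite scale0r add0r normr0; apply.
have Bs (c : R) : `|c| <= `|s| -> ball x r (c *: ei + x + s *: ej).
  by move=> cs; rewrite addrC; exact: B.
pose F z := f (z + s *: ej) - f z.
have [t ts|c cs E] := @mvt_line R m F x ei s.
  apply: derivableB; last exact: (df _ (B0 _ ts)).1.
  apply: derivable_translate; exact: (df _ (Bs _ ts)).1.
have [t ts|d ds E'] := @mvt_line R m (fun z => 'D_ei f z) (c *: ei + x) ej s.
  exact: (df _ (B _ _ cs ts)).2.
exists (d *: ej + (c *: ei + x)); first exact: B.
rewrite -E' -[LHS]/(F (s *: ei + x) - F x) E; congr (_ * _).
rewrite deriveB; last exact: (df _ (B0 _ cs)).1.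
  by rewrite derive_translate [c *: ei + x + _]addrC.
apply: derivable_translate; exact: (df _ (Bs _ cs)).1.
Qed.

(** The second difference does not depend on the order of the two directions,
    so the two mixed derivatives agree at points arbitrarily close to [x];
    continuity concludes. *)
Lemma schwarz f x i j : Cgerm 2 x f ->
  'D_(delta_mx 0 j) (fun z => 'D_(delta_mx 0 i) f z) x
  = 'D_(delta_mx 0 i) (fun z => 'D_(delta_mx 0 j) f z) x.
Proof.
move=> Cf.
set A := (X in X = _); set B := (X in _ = X).
have N i' j' (e : R) : 0 < e -> \forall y \near x, derivable f y (delta_mx 0 i') /\
     derivable (fun z => 'D_(delta_mx 0 i') f z) y (delta_mx 0 j') /\
     `| 'D_(delta_mx 0 j') (fun z => 'D_(delta_mx 0 i') f z) x -
       'D_(delta_mx 0 j') (fun z => 'D_(delta_mx 0 i') f z) y| <= e.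
  move=> e0; have [_ /(_ i') [d1 C1]] := Cf; have [_ /(_ j') [d2 C2]] := C1.
  apply: filterI d1 _; apply: filterI d2 _.
  by have /nbhs_singleton/cvgrPdist_le := C2.1; apply.
have H (e : R) : 0 < e -> `|A - B| <= e.
  move=> e0; have e2 : 0 < e / 2 by rewrite divr_gt0.
  have NN := near_and (N i j _ e2) (N j i _ e2).
  move: NN => /nbhs_ballP[r /= r0 Hr].
  pose s := r / 3; have s0 : 0 < s by rewrite divr_gt0.
  have sr : s + s < r by rewrite /s; lra.
  have [|y /Hr [[_ [_ yA]] _] E1] := @second_difference f x r s i j s0 sr.
    by move=> z /Hr[[? []]].
  have [|z /Hr [_ [_ [_ zB]]] E2] := @second_difference f x r s j i s0 sr.
    by move=> z /Hr[_ [? []]].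
  have C : s *: delta_mx 0 j + x + s *: delta_mx 0 i
      = s *: delta_mx 0 i + x + s *: delta_mx 0 j.
    by rewrite addrC addrA addrAC.
  rewrite C ![x + s *: _]addrC in E1 E2.
  have /(mulfI (lt0r_neq0 s0))/(mulfI (lt0r_neq0 s0)) E :
      s * (s * 'D_(delta_mx 0 j) (fun z => 'D_(delta_mx 0 i) f z) y)
    = s * (s * 'D_(delta_mx 0 i) (fun z => 'D_(delta_mx 0 j) f z) z).
    have comm (f1 f2 f3 f4 : R) : f1 - f2 - (f3 - f4) = f1 - f3 - (f2 - f4) by ring.
    exact: (etrans (esym E1) (etrans (comm _ _ _ _) E2)).
  rewrite -/A in yA; rewrite -/B -E in zB.
  rewrite (splitr e); apply: le_trans (lerD yA zB).
  rewrite [X in _ <= _ + X]distrC; exact: ler_distD.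
apply/eqP; rewrite -subr_eq0 -normr_le0; apply/ler_addgt0Pr => e e0; rewrite add0r; exact: H.
Qed.
End Schwarz.

(** * Smooth bump functions *)

Section Bump.
Context {R : realType}.
Implicit Types (t : R) (n m k : nat).

(** Multiplying exp (- 1 / t) by powers of 1 / t gives a family that is stable
    under differentiation up to linear combinations, see [is_derive_flat], so
    one induction handles all orders. *)
Definition flat n t : R := if 0 < t then t^-1 ^+ n * expR (- t^-1) else 0.

Lemma flat_pos n t : 0 < t -> flat n t = t^-1 ^+ n * expR (- t^-1).
Proof. by rewrite /flat => ->. Qed.

Lemma flat_npos n t : t <= 0 -> flat n t = 0.
Proof. by rewrite /flat; case: ltP. Qed.

Lemma flatS n t : t^-1 * flat n t = flat n.+1 t.
Proof. by rewrite /flat; case: ifP => _; rewrite ?mulr0// exprS mulrA. Qed.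

Lemma flat_ge0 n t : 0 <= flat n t.
Proof.
rewrite /flat; case: ltP => // t0.
by rewrite mulr_ge0 ?expR_ge0// exprn_ge0// invr_ge0 ltW.
Qed.

(** The exponential dominates every power: with u = 1 / t, raise
    exp (u / (n + 1)) >= u / (n + 1) to the power n + 1. This gives the
    continuity at 0 and, at the next index, the derivative there. *)
Lemma flat_le n t : flat n t <= (n.+1%:R) ^+ n.+1 * `|t|.
Proof.
rewrite /flat; case: ltP => t0; last by rewrite mulr_ge0 ?exprn_ge0.
rewrite gtr0_norm//; set u := t^-1; have u0 : 0 < u by rewrite invr_gt0.
have -> : t = u^-1 by rewrite invrK.
have le1 : u / n.+1%:R <= expR (u / n.+1%:R).
  by apply: le_trans (expR_ge1Dx _); rewrite lerDr.
have : (u / n.+1%:R) ^+ n.+1 <= expR u.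
  apply: le_trans (_ : expR (u / n.+1%:R) ^+ n.+1 <= _).
    by rewrite lerXn2r ?nnegrE ?expR_ge0// divr_ge0// ltW.
  by rewrite -expRM_natl -mulr_natl mulrC divfK.
rewrite expr_div_n ler_pdivrMr ?exprn_gt0// => le2.
rewrite expRN ler_pdivrMr ?expR_gt0// -(ler_pM2r u0) -exprSr.
rewrite (le_trans le2)//; move: (_ ^+ _) (expR u) => a b.
by rewrite (_ : a / u * b * u = b * a)//; field; rewrite gt_eqF.
Qed.

Lemma is_derive_flat n t : is_derive t (1 : R) (flat n : R -> R)
  (flat n.+2 t - n%:R * flat n.+1 t).
Proof.
have [t0|t0|->] := ltgtP t 0.
- rewrite !flat_npos ?(ltW t0)// mulr0 subr0.
  apply: (@near_eq_is_derive _ _ _ (cst 0)).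
  have N : \forall y \near t, y < 0 by exact: lt_nbhsl.
  by apply: filterS N => y y0; rewrite flat_npos// ltW.
- have -> : flat n.+2 t - n%:R * flat n.+1 t =
    t^-1 ^+ n *: (expR (- t^-1) * (- (- t ^- 2 *: (1 : R)))) + expR (- t^-1) *:
      ((n%:R * t^-1 ^+ n.-1) *: (- t ^- 2 *: (1 : R))).
    rewrite !flat_pos// /GRing.scale/= -!exprVn.
    case: n => [|n] /=; rewrite !exprS ?expr0; ring.
  apply: (@near_eq_is_derive _ _ _ (fun t => t^-1 ^+ n * expR (- t^-1))).
    have N : \forall y \near t, 0 < y by exact: lt_nbhsr.
    by apply: filterS N => y y0; rewrite flat_pos.
  have dV : is_derive t (1 : R) (fun t : R => t^-1) (- t ^- 2 *: (1 : R)).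
    split; first by apply: derivableV => //; rewrite gt_eqF.
    by rewrite deriveV ?gt_eqF// derive_id.
  have dE : is_derive t (1 : R) (fun t : R => expR (- t^-1))
    (expR (- t^-1) * (- (- t ^- 2 *: (1 : R)))).
    exact: (is_derive1_comp (is_derive_expR _) (is_deriveN dV)).
  have -> : (fun s : R => s^-1 ^+ n * expR (- s^-1))
      = (fun s : R => s^-1) ^+ n * (fun s : R => expR (- s^-1)).
    by apply: funext => s; rewrite [RHS]/GRing.mul/= exprfctE.
  apply: (is_derive_eq (is_deriveM (is_deriveX n dV) dE)).
  by rewrite exprfctE.
- rewrite !flat_npos// mulr0 subr0.
  have E : (fun h : R => h^-1 *: ((flat n \o shift 0) (h *: (1:R)) - flat n 0)) @ 0^' -->
    (0 : R).
    apply/cvgrPdist_le => e e0; pose C : R := (n.+2%:R) ^+ n.+2.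
    have C0 : 0 < C by rewrite exprn_gt0.
    near=> h.
    rewrite /= addr0 [h *: 1]mulr1 (flat_npos n (lexx 0)) subr0 sub0r normrN.
    rewrite [_ *: _]flatS// ger0_norm ?flat_ge0//.
    apply: le_trans (flat_le _ _) _; rewrite -/C -ler_pdivlMl//.
    near: h; apply: dnbhs0_le; rewrite mulr_gt0// invr_gt0//.
  split; last exact/cvg_lim.
  by apply/cvg_ex; exists 0.
Unshelve. all: by end_near. Qed.

Lemma differentiable_flat n t : differentiable (flat n : R -> R) t.
Proof. by apply/derivable1_diffP; have [] := is_derive_flat n t. Qed.

(** The derivative of [flat n] involves [flat n.+1] and [flat n.+2], so [n]
    varies in the induction on [k]. *)
Lemma Cgerm_flat n m k x (g : 'rV[R]_m -> R) : Cgerm k x g ->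
  Cgerm k x (fun y => flat n (g y)).
Proof.
elim: k n g => [|k IH] n g Cg.
  split=> //; apply: filterS (Cgerm_continuous Cg) => y cg.
  by apply: (@continuous_comp _ _ _ g (flat n)) => //;
    apply/differentiable_continuous/differentiable_flat.
have dg := Cgerm_near_differentiable Cg.
apply: CgermS.
  apply: filterS dg => y dgy.
  by apply: (@differentiable_comp _ _ _ _ g (flat n)) => //; exact: differentiable_flat.
move=> i; have Cg' := CgermW Cg.
apply: Cgerm_ext (CgermM (CgermD (IH n.+2 _ Cg')
  (CgermN (CgermM (Cgerm_cst k x n%:R) (IH n.+1 _ Cg'))))
   (Cgerm_partial i Cg)).
apply: filterS dg => y dgy.
have df := differentiable_flat n (g y).
rewrite [RHS]deriveE; last exact: (@differentiable_comp _ _ _ _ g (flat n)).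
rewrite (@diff_comp _ _ _ _ g (flat n))//= -(deriveE _ dgy).
rewrite -[X in 'd _ _ X]mulr1 [RHS]linearZ/= mulrC -deriveE//.
by rewrite (@derive_val _ _ _ _ _ _ _ (is_derive_flat n (g y))).
Qed.

Lemma flat0_gt0 t : 0 < t -> 0 < flat 0 t.
Proof. by move=> t0; rewrite flat_pos// expr0 mul1r expR_gt0. Qed.

(** With q = 2 |x - x0|^2 / r^2 for the Euclidean norm, the bump is
    u / (u + w), where u vanishes for q >= 2 and w for q <= 1; the denominator
    has no zero because these two ranges are disjoint. *)
Lemma bump_exists m (x0 : 'rV[R]_m) (r : R) : 0 < r ->
  exists b : 'rV[R]_m -> R, [/\ forall x, smooth_germ x b,
    \forall y \near x0, b y = 1 & forall y, r < `|y - x0| -> b y = 0].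
Proof.
move=> r0.
pose q (y : 'rV[R]_m) := \sum_j 2 / r ^+ 2 * ((y 0 j + (- x0 0 j)) * (y 0 j + (- x0 0 j))).
have Cq k x : Cgerm k x q.
  apply: Cgerm_sum => j _; apply: CgermM; first exact: Cgerm_cst.
  by apply: CgermM; apply: CgermD; (try exact: Cgerm_coord); exact: (Cgerm_cst k x (- x0 0 j)).
pose u y := flat 0 (2 + - q y); pose w y := flat 0 (q y + -1).
have Cu k x : Cgerm k x u.
  apply: Cgerm_flat; apply: CgermD; first exact: Cgerm_cst.
  exact: CgermN.
have Cw k x : Cgerm k x w.
  by apply: Cgerm_flat; apply: CgermD => //; exact: (Cgerm_cst k x (-1)).
have uw y : 0 < u y + w y.
  have [q2|q2] := ltP (q y) 2.
    by rewrite ltr_wpDr ?flat_ge0// flat0_gt0// subr_gt0.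
  by rewrite ltr_wpDl ?flat_ge0// flat0_gt0// subr_gt0; apply: lt_le_trans q2; rewrite ltr1n.
exists (fun y => u y * (u y + w y)^-1); split.
- move=> x k; apply: CgermM => //; apply: CgermV; first by rewrite gt_eqF.
  exact: CgermD.
- have cq : {for x0, continuous q} := nbhs_singleton (Cgerm_continuous (Cq 0%N x0)).
  have q0 : q x0 = 0 by rewrite /q big1// => j _; rewrite subrr !mulr0.
  have : \forall y \near x0, q y < 1.
    have : nbhs (q x0) [set z | z < 1] by apply: lt_nbhsl; rewrite q0.
    exact: cq.
  apply: filterS => y q1; rewrite /w flat_npos ?subr_le0 ?ltW// addr0 divff//.
  by rewrite gt_eqF// flat0_gt0// subr_gt0 (lt_trans q1)// ltr1n.
- move=> y ry; rewrite /u flat_npos ?mul0r// subr_le0 leNgt; apply/negP => q2.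
  move: ry; rewrite ltNge => /negP; apply; apply: norm_le_coord (ltW r0) _ => j.
  rewrite !mxE leNgt; apply/negP => rj.
  move: q2; rewrite ltNge => /negP; apply; rewrite /q (bigD1 j)//=.
  apply: ler_wpDr; last first.
    rewrite mulrAC ler_pdivlMr ?exprn_gt0// ler_pM2l// -expr2.
    rewrite -[leRHS](real_normK (num_real _)).
    by rewrite lerXn2r ?nnegrE//; exact: ltW.
  apply: sumr_ge0 => l _; apply: mulr_ge0; last by rewrite -expr2 sqr_ge0.
  by rewrite divr_ge0// exprn_ge0// ltW.
Qed.

End Bump.

(** * Smooth functions on a manifold *)

Section Charts.
Context {R : realType} {T : topologicalType} {m : nat}.
Implicit Types (c : chart R T m) (p : T).

Lemma near_cdom c p : cdom c p -> \forall q \near p, cdom c q.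
Proof. by move=> cp; apply: open_nbhs_nbhs; split=> //; exact: open_cdom. Qed.

Lemma near_chart_pull c p (P : 'rV[R]_m -> Prop) : cdom c p ->
  (\forall x \near c p, P x) -> \forall q \near p, P (c q).
Proof. by move=> cp PH; exact: (cmap_cont cp PH). Qed.

Lemma near_chart_push c p (P : T -> Prop) : cdom c p ->
  (\forall q \near p, P q) -> \forall x \near c p, P (cinv c x).
Proof.
move=> cp PH; have ic : (c @` cdom c) (c p) by exists p.
have := @cinv_cont _ _ _ c _ ic; rewrite /prop_for /continuous_at cmapK//.
exact.
Qed.

Lemma near_cinvK c p : cdom c p -> \forall x \near c p, c (cinv c x) = x.
Proof.
move=> cp; have N : nbhs (c p) (c @` cdom c).
  by apply: open_nbhs_nbhs; split; [exact: open_cimg|exists p].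
by apply: filterS N => x [q cq <-]; rewrite cmapK.
Qed.

Lemma open_chart_image c (U : set T) : open U -> open (c @` (U `&` cdom c)).
Proof.
move=> oU; rewrite openE => _ [p [Up cp] <-].
have N : \forall x \near c p, (U `&` cdom c) (cinv c x).
  by apply: near_chart_push => //; apply: open_nbhs_nbhs; split=> //; apply: openI => //;
    exact: open_cdom.
have := near_and N (near_cinvK cp); apply: filterS => x [UV cK].
by exists (cinv c x).
Qed.

End Charts.

(** The chart is irrelevant by [smooth_atP], and on open sets this is
    [smooth_fun] by [smooth_funP]. *)
Definition smooth_at (R : realType) (m : nat) (M : manifold R m) (p : M) (f : M -> R) :=
  exists c : chart R M m, [/\ atlas M c, cdom c p & smooth_germ (c p) (f \o cinv c)].

(** This function, the three scalar operations [partial], [dird] and [mval], and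
    [tcoef] are opaque, so that two values are compared by their arguments alone. *)
HB.lock Definition coordf (R : realType) (m : nat) (M : manifold R m)
  (c : chart R M m) (j : 'I_m) (p : M) : R := c p 0 j.

HB.lock Definition partial (R : realType) (m : nat) (M : manifold R m)
  (c : chart R M m) (j : 'I_m) (f : M -> R) (p : M) : R :=
    'D_(delta_mx 0 j) (f \o cinv c) (c p).

(** The derivative v(f) of a scalar function. The components of a vector field X
    in a chart [c] are the functions [dird (coordf c j) q (X q)]. *)
HB.lock Definition dird (R : realType) (m : nat) (M : manifold R m) (f : M -> R) (p : M)
  (v : 'rV[R]_m) : R := dvec f p v.

Definition vf_at (R : realType) (m : nat) (M : manifold R m) (p : M) (X : vfield M) :=
  exists c : chart R M m, [/\ atlas M c, cdom c p
    & forall j, smooth_at p (fun q => dird (coordf c j) q (X q))].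

Section SmoothAt.
Context {R : realType} {m : nat} {M : manifold R m}.
Implicit Types (p q : M) (f g : M -> R) (c d : chart R M m) (X Y : vfield M).

Lemma smooth_transition_germ c d p j : atlas M c -> atlas M d -> cdom c p -> cdom d p ->
  smooth_germ (c p) (fun x => d (cinv c x) 0 j).
Proof.
move=> ac ad cp dp; have := atlas_compat ac ad j.
rewrite /smooth_transition setIC smooth_onP; last by apply: open_chart_image; exact: open_cdom.
by apply; exists p.
Qed.

Lemma smooth_atP p f c : atlas M c -> cdom c p ->
  smooth_at p f <-> smooth_germ (c p) (f \o cinv c).
Proof.
move=> ac cp; split=> [[d [ad dp fd]] k|]; last by exists c.
have := @Cgerm_comp R m m k (c p) (f \o cinv d) (d \o cinv c).
rewrite /= cmapK// => /(_ (fd k) (fun j => smooth_transition_germ j ac ad cp dp k)).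
apply: Cgerm_ext; have := near_chart_push cp (near_cdom dp).
by apply: filterS => x /= dx; rewrite cmapK.
Qed.

Lemma smooth_at_chart_at p f : smooth_at p f ->
  smooth_germ (chart_at p p) (f \o cinv (chart_at p)).
Proof. by move/(smooth_atP _ (chart_at_atlas p) (chart_at_dom p)). Qed.

Lemma smooth_at_of_chart_at p f : smooth_germ (chart_at p p) (f \o cinv (chart_at p)) ->
  smooth_at p f.
Proof. by move/(smooth_atP _ (chart_at_atlas p) (chart_at_dom p)). Qed.

Lemma smooth_at_ext p f g : (\forall q \near p, f q = g q) -> smooth_at p f -> smooth_at p g.
Proof.
move=> fg /smooth_at_chart_at fs; apply: smooth_at_of_chart_at => k.
exact: Cgerm_ext (near_chart_push (chart_at_dom p) fg) (fs k).
Qed.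

Lemma smooth_at_comp_chart p c (h : 'rV[R]_m -> R) : atlas M c -> cdom c p ->
  smooth_germ (c p) h -> smooth_at p (fun q => h (c q)).
Proof.
move=> ac cp hs; apply/(smooth_atP _ ac cp) => k.
apply: Cgerm_ext (hs k); apply: filterS (near_cinvK cp) => x /= E.
by rewrite E.
Qed.

Lemma smooth_funP U f : open U -> smooth_fun U f <-> forall p, U p -> smooth_at p f.
Proof.
move=> oU; split=> [H p Up|H c ac].
  have := H _ (chart_at_atlas p); rewrite smooth_onP; last exact: open_chart_image.
  move=> /(_ (chart_at p p)) Hp; apply: smooth_at_of_chart_at; apply: Hp.
  by exists p => //; split=> //; exact: chart_at_dom.
apply/smooth_onP; first exact: open_chart_image.
by move=> _ [p [Up cp] <-]; apply/(smooth_atP _ ac cp)/H.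
Qed.

Lemma smooth_at_cst p (a : R) : smooth_at p (fun=> a).
Proof. by apply: smooth_at_of_chart_at => k; exact: Cgerm_cst. Qed.

Lemma smooth_at_coordf p c j : atlas M c -> cdom c p -> smooth_at p (coordf c j).
Proof.
move=> ac cp; rewrite coordf.unlock; apply:
  (smooth_at_comp_chart ac cp (h := fun x => x 0 j)) => k.
exact: Cgerm_coord.
Qed.

Lemma smooth_atD p f g : smooth_at p f -> smooth_at p g -> smooth_at p (fun q => f q + g q).
Proof.
move=> /smooth_at_chart_at fs /smooth_at_chart_at gs; apply: smooth_at_of_chart_at => k.
exact: (CgermD (fs k) (gs k)).
Qed.

Lemma smooth_atM p f g : smooth_at p f -> smooth_at p g -> smooth_at p (fun q => f q * g q).
Proof.
move=> /smooth_at_chart_at fs /smooth_at_chart_at gs; apply: smooth_at_of_chart_at => k.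
exact: (CgermM (fs k) (gs k)).
Qed.

Lemma smooth_atN p f : smooth_at p f -> smooth_at p (fun q => - f q).
Proof.
move=> /smooth_at_chart_at fs; apply: smooth_at_of_chart_at => k.
exact: (CgermN (fs k)).
Qed.

Lemma smooth_atB p f g : smooth_at p f -> smooth_at p g -> smooth_at p (fun q => f q - g q).
Proof. by move=> fs gs; apply: smooth_atD => //; exact: smooth_atN. Qed.

Lemma smooth_atV p f : f p != 0 -> smooth_at p f -> smooth_at p (fun q => (f q)^-1).
Proof.
move=> f0 /smooth_at_chart_at fs; apply: smooth_at_of_chart_at => k.
by apply: (CgermV _ (fs k)); rewrite /= cmapK//; exact: chart_at_dom.
Qed.

Lemma smooth_at_sum p (I : Type) (r : seq I) (P : pred I) (f : I -> M -> R) :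
  (forall i, P i -> smooth_at p (f i)) -> smooth_at p (fun q => \sum_(i <- r | P i) f i q).
Proof.
move=> fs; apply: smooth_at_of_chart_at => k.
by apply: (Cgerm_sum r (f := fun i => f i \o cinv (chart_at p))) => i /fs /smooth_at_chart_at.
Qed.

Lemma smooth_at_prod p (I : Type) (r : seq I) (P : pred I) (f : I -> M -> R) :
  (forall i, P i -> smooth_at p (f i)) -> smooth_at p (fun q => \prod_(i <- r | P i) f i q).
Proof.
move=> fs; elim: r => [|i r IH].
  by apply: smooth_at_ext (smooth_at_cst p 1); apply: near_everywhere => q; rewrite big_nil.
have [Pi|Pi] := boolP (P i).
  by apply: smooth_at_ext (smooth_atM (fs i Pi) IH); apply: near_everywhere => y;
    rewrite big_cons Pi.
by apply: smooth_at_ext IH; apply: near_everywhere => y; rewrite big_cons (negbTE Pi).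
Qed.

Lemma smooth_at_partial p f c j : atlas M c -> cdom c p -> smooth_at p f ->
  smooth_at p (partial c j f).
Proof.
move=> ac cp /(smooth_atP _ ac cp) fs; rewrite partial.unlock; apply:
  (smooth_at_comp_chart ac cp (h := fun x => 'D_(delta_mx 0 j) (f \o cinv c) x)) => k.
exact: Cgerm_partial (fs k.+1).
Qed.

Lemma partialE c j f p : partial c j f p = 'D_(delta_mx 0 j) (f \o cinv c) (c p).
Proof. by rewrite partial.unlock. Qed.

Lemma partialC p f c i j : atlas M c -> cdom c p -> smooth_at p f ->
  partial c i (partial c j f) p = partial c j (partial c i f) p.
Proof.
move=> ac cp /(smooth_atP _ ac cp) fs.
have E l : \forall x \near c p, (partial c l f \o cinv c) x = 'D_(delta_mx 0 l) (f \o cinv c) x.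
  by apply: filterS (near_cinvK cp) => x cK; rewrite /= partialE cK.
rewrite [LHS]partialE [RHS]partialE [LHS](near_eq_derive _ (E j)) [RHS](near_eq_derive _ (E i)).
by rewrite schwarz.
Qed.

Lemma smooth_at_differentiable p f : smooth_at p f ->
  differentiable (f \o cinv (chart_at p)) (chart_at p p).
Proof. by move=> /smooth_at_chart_at /(_ 1%N)/Cgerm_differentiable. Qed.

Lemma dvec_ext (V : normedModType R) (F G : M -> V) p v :
  (\forall q \near p, F q = G q) -> dvec F p v = dvec G p v.
Proof.
move=> FG; apply: near_eq_derive.
exact: near_chart_push (chart_at_dom p) FG.
Qed.

Lemma dirdE p f v : dvec f p v = dird f p v.
Proof. by rewrite dird.unlock. Qed.

Lemma dird_ext p f g v : (\forall q \near p, f q = g q) -> dird f p v = dird g p v.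
Proof. by rewrite dird.unlock; exact: dvec_ext. Qed.

Lemma dird_cst p (a : R) v : dird (fun _ : M => a) p v = 0.
Proof. rewrite dird.unlock; exact: (derive_cst a). Qed.

Lemma dirdD p f g v : smooth_at p f -> smooth_at p g ->
  dird (fun q => f q + g q) p v = dird f p v + dird g p v.
Proof.
move=> /smooth_at_differentiable fs /smooth_at_differentiable gs.
by rewrite dird.unlock /dvec -deriveD//; exact: diff_derivable.
Qed.

Lemma dirdM p f g v : smooth_at p f -> smooth_at p g ->
  dird (fun q => f q * g q) p v = f p * dird g p v + g p * dird f p v.
Proof.
move=> /smooth_at_differentiable fs /smooth_at_differentiable gs.
have cK := cmapK (chart_at_dom p); rewrite dird.unlock.
rewrite /dvec -[LHS]/('D_v ((f \o cinv (chart_at p)) * (g \o cinv (chart_at p)))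
  (chart_at p p)).
by rewrite deriveM//= ?cK//; exact: diff_derivable.
Qed.

Lemma dird_sum p (I : Type) (r : seq I) (f : I -> M -> R) v :
  (forall i, smooth_at p (f i)) ->
  dird (fun q => \sum_(i <- r) f i q) p v = \sum_(i <- r) dird (f i) p v.
Proof.
move=> fs; elim: r => [|i r IH].
  by rewrite big_nil -[RHS](dird_cst p 0 v); apply: dird_ext; apply: near_everywhere => q;
    rewrite big_nil.
rewrite big_cons -IH -dirdD//; last exact: smooth_at_sum.
by apply: dird_ext; apply: near_everywhere => q; rewrite big_cons.
Qed.

Lemma dird_linear p f : smooth_at p f -> forall a u v,
  dird f p (a *: u + v) = a * dird f p u + dird f p v.
Proof.
move=> /smooth_at_differentiable fs a u v; rewrite dird.unlock /dvec !deriveE//.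
exact: linearP.
Qed.

Lemma dird_vecD p f u v : smooth_at p f -> dird f p (u + v) = dird f p u + dird f p v.
Proof. by move=> fs; have := dird_linear fs 1 u v; rewrite scale1r mul1r. Qed.

Lemma dird_vec0 p f : smooth_at p f -> dird f p 0 = 0.
Proof. by move=> fs; apply: (addrI (dird f p 0)); rewrite -dird_vecD// !addr0. Qed.

Lemma dird_vec_sum p f (I : Type) (r : seq I) (u : I -> 'rV[R]_m) : smooth_at p f ->
  dird f p (\sum_(j <- r) u j) = \sum_(j <- r) dird f p (u j).
Proof.
by move=> fs; elim: r => [|j r IH]; rewrite ?big_nil ?dird_vec0// !big_cons dird_vecD// IH.
Qed.

Lemma dird_vecZ p f a u : smooth_at p f -> dird f p (a *: u) = a * dird f p u.
Proof. by move=> fs; have := dird_linear fs a u 0; rewrite dird_vec0// !addr0. Qed.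

End SmoothAt.

(** * Derivatives along vectors, and vector fields *)

Section Dvec.
Context {R : realType} {m k : nat} {M : manifold R m} {N : manifold R k}.
Implicit Types (p q : M).

Lemma dvec_rV n p (F : M -> 'rV[R]_n) v j : (forall j, smooth_at p (fun q => F q 0 j)) ->
  (dvec F p v : 'rV[R]_n) 0 j = dird (fun q => F q 0 j) p v.
Proof.
move=> Fs; rewrite dird.unlock /dvec derive_rV//; apply: differentiable_rV => i.
exact: smooth_at_differentiable (Fs i).
Qed.

Lemma dird_comp (F : M -> N) p (c : chart R N k) (f : N -> R) v :
  atlas N c -> cdom c (F p) -> {for p, continuous F} ->
  (forall j, smooth_at p (fun q => coordf c j (F q))) -> smooth_at (F p) f ->
  dird (fun q => f (F q)) p v = \sum_j dird (fun q => coordf c j (F q)) p v * partial c j f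
    (F p).
Proof.
move=> ac cp cF + /(smooth_atP _ ac cp) fs; rewrite coordf.unlock => Fs.
have cK := cmapK (chart_at_dom p).
have dF : differentiable ((c \o F) \o cinv (chart_at p)) (chart_at p p).
  by apply: differentiable_rV => i; exact: smooth_at_differentiable (Fs i).
have df : differentiable (f \o cinv c) (c (F p)) by exact: Cgerm_differentiable (fs 1%N).
have -> : dird (fun q => f (F q)) p v =
    'D_v ((f \o cinv c) \o ((c \o F) \o cinv (chart_at p))) (chart_at p p).
  rewrite dird.unlock; apply: near_eq_derive; apply: (near_chart_push (chart_at_dom p)
    (P := fun q => f (F q) = f (cinv c (c (F q))))).
  have := continuous_near cF (near_cdom cp); apply: filterS => q cq.
  by rewrite cmapK.
rewrite derive_comp//= ?cK// derive_sum_partials// partial.unlock dird.unlock.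
by apply: eq_bigr => j _; rewrite derive_rV.
Qed.

End Dvec.

Section Fields.
Context {R : realType} {m : nat} {M : manifold R m}.
Implicit Types (p q : M) (f g : M -> R) (c d : chart R M m) (X Y : vfield M).

Lemma dird_chart c p f v : atlas M c -> cdom c p -> smooth_at p f ->
  dird f p v = \sum_j dird (coordf c j) p v * partial c j f p.
Proof.
move=> ac cp fs; apply: (@dird_comp R m m M M id p c f v) => // j.
exact: smooth_at_coordf.
Qed.

Lemma dvec_coordf c p v j : atlas M c -> cdom c p ->
  (dvec c p v : 'rV[R]_m) 0 j = dird (coordf c j) p v.
Proof.
move=> ac cp; rewrite dvec_rV ?coordf.unlock// => i.
by have := smooth_at_coordf i ac cp; rewrite coordf.unlock.
Qed.

Lemma partial_coordf c p i j : cdom c p -> partial c i (coordf c j) p = (i == j)%:R.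
Proof.
move=> cp; rewrite partialE coordf.unlock (near_eq_derive (g := fun x : 'rV[R]_m => x 0 j)).
  by rewrite derive_coord mxE eqxx/= eq_sym.
by apply: filterS (near_cinvK cp) => x /= ->.
Qed.

Lemma coord_vfE c p i j d : atlas M c -> atlas M d -> cdom c p -> cdom d p ->
  ('D_(delta_mx 0 i) (d \o cinv c) (c p)) 0 j = partial c i (coordf d j) p.
Proof.
move=> ac ad cp dp; rewrite derive_rV ?partial.unlock ?coordf.unlock//; apply:
  differentiable_rV => l.
exact: Cgerm_differentiable (smooth_transition_germ l ac ad cp dp 1%N).
Qed.

Lemma dird_coord_vf c p f i : atlas M c -> cdom c p -> smooth_at p f ->
  dird f p (coord_vf c i p) = partial c i f p.
Proof.
move=> ac cp fs; set d := chart_at p.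
have dp : cdom d p := chart_at_dom p. have ad : atlas M d := chart_at_atlas p.
have cK := cmapK cp.
have df := smooth_at_differentiable fs.
have dird' : differentiable (d \o cinv c) (c p).
  by apply: differentiable_rV => l; exact:
    Cgerm_differentiable (smooth_transition_germ l ac ad cp dp 1%N).
rewrite partialE (near_eq_derive (g := (f \o cinv d) \o (d \o cinv c))).
  by rewrite derive_comp//= cK// dird.unlock.
have := near_chart_push cp (near_cdom dp); apply: filterS => x dx /=.
by rewrite cmapK.
Qed.

Lemma dird_coordf_coord_vf c p i j : atlas M c -> cdom c p ->
  dird (coordf c j) p (coord_vf c i p) = (i == j)%:R.
Proof.
by move=> ac cp; rewrite dird_coord_vf ?partial_coordf//; exact: smooth_at_coordf.
Qed.

Lemma dvec_chart_at p v : dvec (chart_at p) p v = v.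
Proof.
rewrite /dvec (near_eq_derive (g := id)) ?derive_id//.
exact: near_cinvK (chart_at_dom p).
Qed.

Lemma dird_chart_at p v j : dird (coordf (chart_at p) j) p v = v 0 j.
Proof.
by rewrite -dvec_coordf ?dvec_chart_at//; [exact: chart_at_atlas|exact: chart_at_dom].
Qed.

(** Both sides have the same components in the preferred chart, by the chain
    rule for the change of coordinates. *)
Lemma vf_decomp c p v : atlas M c -> cdom c p ->
  v = \sum_j dird (coordf c j) p v *: coord_vf c j p.
Proof.
move=> ac cp; have ap := chart_at_atlas p; have dp := chart_at_dom p.
apply/rowP => k; rewrite summxE -(dird_chart_at p).
rewrite (dird_chart v ac cp); last exact: smooth_at_coordf.
apply: eq_bigr => j _; rewrite mxE; congr (_ * _).
by rewrite -coord_vfE.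
Qed.

Lemma coordf_inj c p u v : atlas M c -> cdom c p ->
  (forall j, dird (coordf c j) p u = dird (coordf c j) p v) -> u = v.
Proof.
move=> ac cp E; rewrite (vf_decomp u ac cp) [RHS](vf_decomp v ac cp).
by apply: eq_bigr => j _; rewrite E.
Qed.

Lemma vf_atP c p X : atlas M c -> cdom c p ->
  vf_at p X <-> forall j, smooth_at p (fun q => dird (coordf c j) q (X q)).
Proof.
move=> ac cp; split=> [[d [ad dp Xs]] j|]; last by exists c.
apply: (@smooth_at_ext _ _ _ _ (fun q =>
  \sum_i dird (coordf d i) q (X q) * partial d i (coordf c j) q)).
  have := near_and (near_cdom cp) (near_cdom dp); apply: filterS => q [cq dq].
  by rewrite [RHS](dird_chart _ ad dq)//; exact: smooth_at_coordf.
apply: smooth_at_sum => i _; apply: smooth_atM => //; apply: smooth_at_partial => //.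
exact: smooth_at_coordf.
Qed.

Lemma smooth_vfP U X : open U -> smooth_vf U X <-> forall p, U p -> vf_at p X.
Proof.
have oD c : open (U `&` cdom c) -> forall j,
    smooth_fun (U `&` cdom c) (fun p => (dvec c p (X p) : 'rV[R]_m) 0 j) <->
    forall p, (U `&` cdom c) p -> smooth_at p (fun p => (dvec c p (X p) : 'rV[R]_m) 0 j).
  by move=> oU j; exact: smooth_funP.
move=> oU; have oUc c : open (U `&` cdom c) by apply: openI => //; exact: open_cdom.
have E c j p : atlas M c -> cdom c p ->
    \forall q \near p, (dvec c q (X q) : 'rV[R]_m) 0 j = dird (coordf c j) q (X q).
  by move=> ac cp; apply: filterS (near_cdom cp) => q cq; exact: dvec_coordf.
split=> [H p Up|H c ac j].
  have ap := chart_at_atlas p; have dp := chart_at_dom p.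
  apply/(vf_atP _ ap dp) => j; apply: smooth_at_ext (E _ j _ ap dp) _.
  by move: (H _ ap j) => /(oD _ (oUc _)); apply.
apply/(oD _ (oUc _)) => p [Up cp].
apply: smooth_at_ext (_ : smooth_at p (fun q => dird (coordf c j) q (X q))).
  by apply: filterS (E c j p ac cp) => q ->.
by move: j; apply/(vf_atP _ ac cp)/H.
Qed.

Lemma smooth_at_dird p f X : (\forall q \near p, smooth_at q f) -> vf_at p X ->
  smooth_at p (fun q => dird f q (X q)).
Proof.
have ac := chart_at_atlas p; have cp := chart_at_dom p.
move=> fn /(vf_atP _ ac cp) Xs.
apply: (@smooth_at_ext _ _ _ _ (fun q =>
  \sum_i dird (coordf (chart_at p) i) q (X q) * partial (chart_at p) i f q)).
  have := near_and (near_cdom cp) fn; apply: filterS => q [cq fq].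
  by rewrite [RHS](dird_chart _ ac cq).
apply: smooth_at_sum => i _; apply: smooth_atM => //; apply: smooth_at_partial => //.
exact: nbhs_singleton fn.
Qed.

End Fields.

(** * The Lie bracket *)

Section Lie.
Context {R : realType} {m : nat} {M : manifold R m}.
Implicit Types (p q : M) (f g : M -> R) (c d : chart R M m) (X Y : vfield M).

Lemma dird_coordfD c p j u v : atlas M c -> cdom c p ->
  dird (coordf c j) p (u + v) = dird (coordf c j) p u + dird (coordf c j) p v.
Proof. by move=> ac cp; rewrite dird_vecD//; exact: smooth_at_coordf. Qed.

Lemma dird_coordfZ c p j a v : atlas M c -> cdom c p ->
  dird (coordf c j) p (a *: v) = a * dird (coordf c j) p v.
Proof. by move=> ac cp; rewrite dird_vecZ//; exact: smooth_at_coordf. Qed.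

Lemma dird_coordf0 c p j : atlas M c -> cdom c p -> dird (coordf c j) p 0 = 0.
Proof. by move=> ac cp; rewrite dird_vec0//; exact: smooth_at_coordf. Qed.

Lemma vf_at_ext p X Y : (\forall q \near p, X q = Y q) -> vf_at p X -> vf_at p Y.
Proof.
have ac := chart_at_atlas p; have cp := chart_at_dom p.
move=> XY /(vf_atP _ ac cp) Xs; apply/(vf_atP _ ac cp) => j.
by apply: smooth_at_ext (Xs j); apply: filterS XY => q ->.
Qed.

Lemma vf_atD p X Y : vf_at p X -> vf_at p Y -> vf_at p (fun q => X q + Y q).
Proof.
have ac := chart_at_atlas p; have cp := chart_at_dom p.
move=> /(vf_atP _ ac cp) Xs /(vf_atP _ ac cp) Ys; apply/(vf_atP _ ac cp) => j.
apply: smooth_at_ext (smooth_atD (Xs j) (Ys j)); apply: filterS (near_cdom cp) => q cq.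
by rewrite dird_coordfD.
Qed.

Lemma vf_atZ p f X : smooth_at p f -> vf_at p X -> vf_at p (fun q => f q *: X q).
Proof.
have ac := chart_at_atlas p; have cp := chart_at_dom p.
move=> fs /(vf_atP _ ac cp) Xs; apply/(vf_atP _ ac cp) => j.
apply: smooth_at_ext (smooth_atM fs (Xs j)); apply: filterS (near_cdom cp) => q cq.
by rewrite dird_coordfZ.
Qed.

Lemma vf_at_cst0 p : vf_at p (fun=> 0 : 'rV[R]_m).
Proof.
have ac := chart_at_atlas p; have cp := chart_at_dom p.
apply/(vf_atP _ ac cp) => j; apply: smooth_at_ext (smooth_at_cst p 0).
by apply: filterS (near_cdom cp) => q cq; rewrite dird_coordf0.
Qed.

Lemma vf_at_sum p (I : Type) (r : seq I) (X : I -> vfield M) :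
  (forall i, vf_at p (X i)) -> vf_at p (fun q => \sum_(i <- r) X i q).
Proof.
move=> Xs; elim: r => [|i r IH].
  by apply: vf_at_ext (vf_at_cst0 p); apply: near_everywhere => q; rewrite big_nil.
by apply: vf_at_ext (vf_atD (Xs i) IH); apply: near_everywhere => q; rewrite big_cons.
Qed.

Lemma vf_at_coord c p i : atlas M c -> cdom c p -> vf_at p (coord_vf c i).
Proof.
move=> ac cp; apply/(vf_atP _ ac cp) => j.
apply: smooth_at_ext (smooth_at_cst p (i == j)%:R).
by apply: filterS (near_cdom cp) => q cq; rewrite dird_coordf_coord_vf.
Qed.

Lemma smooth_coord_vf c i : atlas M c -> smooth_vf (cdom c) (coord_vf c i).
Proof.
by move=> ac; apply/smooth_vfP; [exact: open_cdom|move=> p cp; exact: vf_at_coord].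
Qed.

(** In the commutator XY - YX of derivations the second derivatives of [f]
    cancel by Schwarz's theorem; this frees the bracket from the preferred
    chart in which it is defined. *)
Lemma dird_lie f p X Y : (\forall q \near p, smooth_at q f) -> vf_at p X -> vf_at p Y ->
  dird f p (lie X Y p)
  = dird (fun q => dird f q (Y q)) p (X p) - dird (fun q => dird f q (X q)) p (Y p).
Proof.
have ac := chart_at_atlas p; have cp := chart_at_dom p.
have [c Ec] : exists c, c = chart_at p by exists (chart_at p).
rewrite -Ec in ac cp => fn /(vf_atP _ ac cp) Xs /(vf_atP _ ac cp) Ys.
have fs := nbhs_singleton fn.
have D Z W : (forall j, smooth_at p (fun q => dird (coordf c j) q (Z q))) ->
  dird (fun q => dird f q (Z q)) p (W p) =
  \sum_j \sum_i dird (coordf c j) p (Z p) *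
    (dird (coordf c i) p (W p) * partial c i (partial c j f) p)
  + \sum_j partial c j f p * dird (fun q => dird (coordf c j) q (Z q)) p (W p).
  move=> Zs; rewrite (@dird_ext _ _ _ _ _
    (fun q => \sum_j dird (coordf c j) q (Z q) * partial c j f q)).
    rewrite dird_sum; last by move=> j; apply: smooth_atM => //; exact: smooth_at_partial.
    rewrite -big_split; apply: eq_bigr => j _ /=.
    rewrite dirdM//; last exact: smooth_at_partial.
    by rewrite (dird_chart (f := partial c j f) _ ac cp) ?mulr_sumr//; exact: smooth_at_partial.
  have := near_and fn (near_cdom cp); apply: filterS => q [fq cq].
  exact: dird_chart.
rewrite (D _ _ Xs) (D _ _ Ys) (dird_chart _ ac cp)//.
have -> : \sum_j \sum_i dird (coordf c j) p (X p) *
  (dird (coordf c i) p (Y p) * partial c i (partial c j f) p)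
  = \sum_j \sum_i dird (coordf c j) p (Y p) *
    (dird (coordf c i) p (X p) * partial c i (partial c j f) p).
  rewrite exchange_big/=; apply: eq_bigr => j _; apply: eq_bigr => i _.
  by rewrite partialC// mulrCA.
rewrite opprD addrACA subrr add0r -sumrB; apply: eq_bigr => j _.
have L : dird (coordf c j) p (lie X Y p) = dird (fun q => dird (coordf c j) q (Y q)) p (X p)
   - dird (fun q => dird (coordf c j) q (X q)) p (Y p).
  have V Z W : (forall j, smooth_at p (fun q => dird (coordf c j) q (Z q))) ->
    (dvec (fun q => dvec c q (Z q)) p (W p) : 'rV[R]_m) 0 j =
      dird (fun q => dird (coordf c j) q (Z q)) p (W p).
    move=> Zs; have N l : \forall q \near p, dird (coordf c l) q (Z q) =
      (dvec c q (Z q) : 'rV[R]_m) 0 l.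
      by apply: filterS (near_cdom cp) => q cq; rewrite dvec_coordf.
    rewrite dvec_rV; last by move=> l; exact: smooth_at_ext (N l) (Zs l).
    by apply: dird_ext; apply: filterS (N j).
  rewrite [in LHS]Ec dird_chart_at /lie -Ec -(V Y X Ys) -(V X Y Xs).
  by rewrite mxE; congr (_ + _); rewrite mxE.
by rewrite L mulrBl ![_ * partial _ _ _ _]mulrC.
Qed.

Lemma lie_coord c p i j : atlas M c -> cdom c p -> lie (coord_vf c i) (coord_vf c j) p = 0.
Proof.
move=> ac cp; apply: (coordf_inj ac cp) => k; rewrite dird_coordf0//.
have cs : \forall q \near p, smooth_at q (coordf c k).
  by apply: filterS (near_cdom cp) => q cq; exact: smooth_at_coordf.
rewrite dird_lie//; try exact: vf_at_coord.
have Z l : \forall q \near p, dird (coordf c k) q (coord_vf c l q) = (l == k)%:R.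
  by apply: filterS (near_cdom cp) => q cq; rewrite dird_coordf_coord_vf.
have D l v := etrans (dird_ext v (Z l)) (dird_cst p _ v).
apply/eqP; rewrite subr_eq0; apply/eqP; exact: (etrans (D _ _) (esym (D _ _))).
Qed.

End Lie.

(** * Bilinear forms *)

Section Bil.
Context {R : realType} {m : nat}.
Implicit Types (G : 'M[R]_m) (u v w : 'rV[R]_m).

Lemma bilE G u v : bil G u v = \sum_i \sum_j u 0 i * G i j * v 0 j.
Proof.
rewrite /bil mxE exchange_big/=; apply: eq_bigr => j _.
by rewrite mxE mulr_suml; apply: eq_bigr => i _; rewrite [v^T _ _]mxE.
Qed.

Lemma bilDl G u v w : bil G (u + v) w = bil G u w + bil G v w.
Proof. by rewrite /bil !mulmxDl mxE. Qed.

Lemma bilDr G u v w : bil G w (u + v) = bil G w u + bil G w v.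
Proof. by rewrite /bil linearD mulmxDr mxE. Qed.

Lemma bilZl G a u w : bil G (a *: u) w = a * bil G u w.
Proof. by rewrite /bil -!scalemxAl mxE. Qed.

Lemma bilZr G a u w : bil G w (a *: u) = a * bil G w u.
Proof. by rewrite /bil linearZ -scalemxAr mxE. Qed.

Lemma bil0l G w : bil G 0 w = 0.
Proof. by rewrite /bil !mul0mx mxE. Qed.

Lemma bil0r G w : bil G w 0 = 0.
Proof. by rewrite /bil trmx0 mulmx0 mxE. Qed.

Lemma bilBl G u v w : bil G (u - v) w = bil G u w - bil G v w.
Proof. by rewrite bilDl -scaleN1r bilZl mulN1r. Qed.

Lemma bil_suml G (I : Type) (r : seq I) (u : I -> 'rV[R]_m) w :
  bil G (\sum_(i <- r) u i) w = \sum_(i <- r) bil G (u i) w.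
Proof. by elim: r => [|i r IH]; rewrite ?big_nil ?bil0l// !big_cons bilDl IH. Qed.

Lemma bil_sumr G (I : Type) (r : seq I) (u : I -> 'rV[R]_m) w :
  bil G w (\sum_(i <- r) u i) = \sum_(i <- r) bil G w (u i).
Proof. by elim: r => [|i r IH]; rewrite ?big_nil ?bil0r// !big_cons bilDr IH. Qed.

Lemma bilC G u v : G^T = G -> bil G u v = bil G v u.
Proof.
move=> sG; rewrite /bil -[LHS]/((u *m G *m v^T) 0 0) -[u *m G *m v^T]trmxK mxE.
by rewrite !trmx_mul trmxK sG mulmxA.
Qed.

End Bil.

HB.lock Definition mval (R : realType) (m : nat) (M : manifold R m) (g : tensor02 M) (p : M)
  (u v : 'rV[R]_m) : R := bil (g p) u v.

Section MetricValue.
Context {R : realType} {m : nat} {M : manifold R m} (g : tensor02 M) (p : M).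
Implicit Types (u v w : 'rV[R]_m).

Lemma mvalE u v : bil (g p) u v = mval g p u v. Proof. by rewrite mval.unlock. Qed.

Lemma mvalDl u v w : mval g p (u + v) w = mval g p u w + mval g p v w.
Proof. by rewrite mval.unlock bilDl. Qed.

Lemma mvalDr u v w : mval g p w (u + v) = mval g p w u + mval g p w v.
Proof. by rewrite mval.unlock bilDr. Qed.

Lemma mvalZl a u w : mval g p (a *: u) w = a * mval g p u w.
Proof. by rewrite mval.unlock bilZl. Qed.

Lemma mvalZr a u w : mval g p w (a *: u) = a * mval g p w u.
Proof. by rewrite mval.unlock bilZr. Qed.

Lemma mvalBl u v w : mval g p (u - v) w = mval g p u w - mval g p v w.
Proof. by rewrite mval.unlock bilBl. Qed.

Lemma mval_suml (I : Type) (r : seq I) (u : I -> 'rV[R]_m) w :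
  mval g p (\sum_(i <- r) u i) w = \sum_(i <- r) mval g p (u i) w.
Proof. by rewrite mval.unlock bil_suml. Qed.

Lemma mval_sumr (I : Type) (r : seq I) (u : I -> 'rV[R]_m) w :
  mval g p w (\sum_(i <- r) u i) = \sum_(i <- r) mval g p w (u i).
Proof. by rewrite mval.unlock bil_sumr. Qed.

Lemma mvalC u v : (g p)^T = g p -> mval g p u v = mval g p v u.
Proof. by rewrite mval.unlock => /bilC. Qed.

End MetricValue.

(** * Smooth maps *)

Section SmoothMap.
Context {R : realType} {m k : nat} {M : manifold R m} {N : manifold R k}.
Context {F : M -> N}.
Hypothesis smF : smooth_map F.
Implicit Types (p q : M) (c : chart R N k) (X Y Z : vfield M).

Let cF p : {for p, continuous F} := smF.1 p.

Lemma near_smooth_map p (P : N -> Prop) :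
  (\forall y \near F p, P y) -> \forall q \near p, P (F q).
Proof. exact: continuous_near. Qed.

Lemma smooth_map_coordf c p j : atlas N c -> cdom c (F p) ->
  smooth_at p (fun q => coordf c j (F q)).
Proof.
move=> ac cp; have [cnF H] := smF.
have := H _ c (chart_at_atlas p) ac j; rewrite setIC smooth_onP; last first.
  apply: open_chart_image; apply: open_comp; last exact: open_cdom.
  by move=> x _; exact: cnF.
move=> /(_ (chart_at p p)) Hp; rewrite coordf.unlock; apply: smooth_at_of_chart_at; apply: Hp.
by exists p => //; split=> //; exact: chart_at_dom.
Qed.

Lemma smooth_at_pull p (f : N -> R) : smooth_at (F p) f -> smooth_at p (fun q => f (F q)).
Proof.
move=> /smooth_at_chart_at fs; apply: smooth_at_of_chart_at => l.
have ac := chart_at_atlas (F p); have cp := chart_at_dom (F p).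
move: (chart_at (F p)) ac cp fs => c ac cp fs.
have dp := chart_at_dom p; have := fun j => smooth_at_chart_at (smooth_map_coordf j ac cp).
move: (chart_at p) dp => d dp Fs.
have := @Cgerm_comp R m k l (d p) (f \o cinv c) (c \o F \o cinv d).
rewrite /= cmapK// => /(_ (fs l)) H.
apply: Cgerm_ext (H _); last by move=> j; move: (Fs j l); rewrite coordf.unlock.
have := near_chart_push dp (near_smooth_map (near_cdom cp)).
by apply: filterS => x cx /=; rewrite cmapK.
Qed.

Lemma tmapE p v j : tmap F p v 0 j = dird (fun q => coordf (chart_at (F p)) j (F q)) p v.
Proof.
have S i := smooth_map_coordf i (chart_at_atlas (F p)) (chart_at_dom (F p)).
rewrite coordf.unlock in S *; by rewrite /tmap dvec_rV.
Qed.

(** The chain rule in the preferred chart at [F p], whose coordinates are the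
    components of [tmap F p v]. *)
Lemma dird_tmap p (f : N -> R) v : smooth_at (F p) f ->
  dird f (F p) (tmap F p v) = dird (fun q => f (F q)) p v.
Proof.
move=> fs; have ac := chart_at_atlas (F p); have cp := chart_at_dom (F p).
rewrite (dird_chart _ ac cp)// (dird_comp _ ac cp)//; last first.
  by move=> j; exact: smooth_map_coordf.
by apply: eq_bigr => j _; rewrite dird_chart_at tmapE.
Qed.

Lemma tmap_linear p : linear (tmap F p).
Proof.
move=> a u v; apply/rowP => j.
have S := smooth_map_coordf j (chart_at_atlas (F p)) (chart_at_dom (F p)).
rewrite [RHS]mxE [X in _ = X + _]mxE.
apply: (etrans (tmapE p (a *: u + v) j)); apply: (etrans (dird_linear S a u v)).
by congr (_ * _ + _); apply/esym/tmapE.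
Qed.

Lemma tmapD p u v : tmap F p (u + v) = tmap F p u + tmap F p v.
Proof. by have := tmap_linear p 1 u v; rewrite !scale1r. Qed.

Lemma tmap0 p : tmap F p 0 = 0.
Proof. by apply: (addrI (tmap F p 0)); rewrite -tmapD !addr0. Qed.

Lemma tmapZ p a u : tmap F p (a *: u) = a *: tmap F p u.
Proof. by have := tmap_linear p a u 0; rewrite tmap0 !addr0. Qed.

Lemma tmap_sum p (I : Type) (r : seq I) (u : I -> 'rV[R]_m) :
  tmap F p (\sum_(i <- r) u i) = \sum_(i <- r) tmap F p (u i).
Proof. by elim: r => [|i r IH]; rewrite ?big_nil ?tmap0// !big_cons tmapD IH. Qed.

Lemma mval_pullback (h : tensor02 N) p u v :
  mval (pullback F h) p u v = mval h (F p) (tmap F p u) (tmap F p v).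
Proof.
rewrite mval.unlock bilE [u in RHS]row_sum_delta [v in RHS]row_sum_delta !tmap_sum bil_suml.
apply: eq_bigr => i _; rewrite bil_sumr; apply: eq_bigr => j _.
by rewrite !tmapZ bilZl bilZr mxE; ring.
Qed.

Lemma smooth_at_tmap c p X j : atlas N c -> cdom c (F p) -> vf_at p X ->
  smooth_at p (fun q => dird (fun q => coordf c j (F q)) q (X q)).
Proof.
move=> ac cp Xs; apply: smooth_at_dird => //.
by apply: filterS (near_smooth_map (near_cdom cp)) => q cq; exact: smooth_map_coordf.
Qed.

End SmoothMap.

(** * Coefficients of a tensor *)

HB.lock Definition tcoef (R : realType) (m : nat) (M : manifold R m) (g : tensor02 M)
  (c : chart R M m) (i j : 'I_m) (p : M) : R := mval g p (coord_vf c i p) (coord_vf c j p).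

Section Tensor.
Context {R : realType} {m : nat} {M : manifold R m} (g : tensor02 M).

Lemma smooth_tensorP (p : M) X Y : smooth_tensor02 g ->
  (\forall q \near p, vf_at q X) -> (\forall q \near p, vf_at q Y) ->
  smooth_at p (fun q => mval g q (X q) (Y q)).
Proof.
rewrite mval.unlock.
move=> gs Xn Yn; have [U [oU Up sU]] := near_open (near_and Xn Yn).
have /smooth_funP : smooth_fun U (fun p => bil (g p) (X p) (Y p)).
  by apply: gs => //; apply/smooth_vfP => // q /sU [].
exact.
Qed.

Lemma tcoefE c i j p : mval g p (coord_vf c i p) (coord_vf c j p) = tcoef g c i j p.
Proof. by rewrite tcoef.unlock. Qed.

Lemma smooth_tcoef c i j p : smooth_tensor02 g -> atlas M c -> cdom c p ->
  smooth_at p (tcoef g c i j).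
Proof.
move=> gs ac cp; rewrite tcoef.unlock; apply: smooth_tensorP => //.
  by apply: filterS (near_cdom cp) => q cq; exact: vf_at_coord.
by apply: filterS (near_cdom cp) => q cq; exact: vf_at_coord.
Qed.

Lemma mval_tcoef c p u v : atlas M c -> cdom c p ->
  mval g p u v = \sum_i \sum_j tcoef g c i j p *
    (dird (coordf c i) p u * dird (coordf c j) p v).
Proof.
move=> ac cp; rewrite [u in LHS](vf_decomp u ac cp) [v in LHS](vf_decomp v ac cp) mval_suml.
apply: eq_bigr => i _; rewrite mval_sumr; apply: eq_bigr => j _.
by rewrite mvalZl mvalZr -tcoefE; ring.
Qed.

End Tensor.

(** * The Koszul formula *)

(** For the Levi-Civita connection of a nondegenerate [g] this is twice
    g(nabla_X Y, Z); the expression itself involves only [g], which may be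
    degenerate. *)
Definition koszul (R : realType) (m : nat) (M : manifold R m) (g : tensor02 M)
  (X Y Z : vfield M) (p : M) : R :=
  dird (fun q => mval g q (Y q) (Z q)) p (X p) + dird (fun q => mval g q (X q) (Z q)) p (Y p)
  - dird (fun q => mval g q (X q) (Y q)) p (Z p)
  + mval g p (lie X Y p) (Z p) - mval g p (lie X Z p) (Y p) - mval g p (lie Y Z p) (X p).

Lemma cov_tensorE (R : realType) (m : nat) (M : manifold R m) (D : connection M)
  (g : tensor02 M) (X Y Z : vfield M) (p : M) :
  cov_tensor D g X Y Z p = dird (fun q => mval g q (Y q) (Z q)) p (X p)
    - mval g p (D X Y p) (Z p) - mval g p (Y p) (D X Z p).
Proof. by rewrite /cov_tensor mval.unlock dird.unlock. Qed.

Section Along.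
Context {R : realType} {m k : nat} {M : manifold R m} {N : manifold R k}.
Context {F : M -> N} {h : tensor02 N} {D : connection N}.
Hypotheses (smF : smooth_map F) (smh : smooth_tensor02 h)
  (symh : forall y, (h y)^T = h y) (LC : levi_civita h D).
Implicit Types (p q : M) (X Y Z : vfield M).

Let E (y : N) i : 'rV[R]_k := coord_vf (chart_at y) i y.
Let Gamma (y : N) b i : 'rV[R]_k := D (coord_vf (chart_at y) b) (coord_vf (chart_at y) i) y.
Let comp p X i q : R := dird (fun r => coordf (chart_at (F p)) i (F r)) q (X q).

Lemma tmap_coord p v :
  tmap F p v = \sum_i dird (fun r => coordf (chart_at (F p)) i (F r)) p v *: E (F p) i.
Proof.
rewrite [LHS](vf_decomp _ (chart_at_atlas (F p)) (chart_at_dom (F p))).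
apply: eq_bigr => i _; rewrite dird_tmap//; apply: smooth_at_coordf.
  exact: chart_at_atlas.
exact: chart_at_dom.
Qed.

(** The connection along [F] in the coordinate frame of the target: the second
    term is linear in the frame vectors, as for a product Y^i d_i. *)
Lemma nabla_alongE p X Y : vf_at p Y -> nabla_along F D X Y p =
  \sum_i (dird (comp p Y i) p (X p) *: E (F p) i
     + comp p Y i p *: \sum_b comp p X b p *: Gamma (F p) b i).
Proof.
move=> Ys; rewrite /nabla_along big_split/=; congr (_ + _); last first.
  rewrite exchange_big/=; apply: eq_bigr => i _; rewrite scaler_sumr.
  apply: eq_bigr => b _; rewrite scalerA mulrC !tmapE//.
have ac := chart_at_atlas (F p); have cp := chart_at_dom (F p).
rewrite [LHS](vf_decomp _ ac cp).
apply: eq_bigr => i _; congr (_ *: _); rewrite dird_chart_at.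
have Ys' j : smooth_at p (comp p Y j) by exact: smooth_at_tmap.
have N' j : \forall q \near p, comp p Y j q =
  (dvec (chart_at (F p) \o F) q (Y q) : 'rV[R]_k) 0 j.
  apply: filterS (near_smooth_map smF (near_cdom cp)) => q cq.
  rewrite dvec_rV /comp ?coordf.unlock// => l.
  by have := smooth_map_coordf smF l ac cq; rewrite coordf.unlock.
rewrite dvec_rV; last by move=> l; exact: smooth_at_ext (N' l) (Ys' l).
by apply: dird_ext; apply: filterS (N' i).
Qed.

(** In coordinates g(Y, Z) is a sum of G_ij Y^i Z^j. The derivative of G_ij along
    X is the image under [F] of a combination of coordinate derivatives, where
    compatibility of the ambient connection with the ambient metric applies;
    the remaining terms are those of the product rule. *)
Lemma metric_along p X Y Z : vf_at p Y -> vf_at p Z ->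
  dird (fun q => mval (pullback F h) q (Y q) (Z q)) p (X p) =
  mval h (F p) (nabla_along F D X Y p) (tmap F p (Z p))
  + mval h (F p) (tmap F p (Y p)) (nabla_along F D X Z p).
Proof.
move=> Ys Zs; have ac := chart_at_atlas (F p); have cp := chart_at_dom (F p).
have Ys' j : smooth_at p (comp p Y j) by exact: smooth_at_tmap.
have Zs' j : smooth_at p (comp p Z j) by exact: smooth_at_tmap.
rewrite !nabla_alongE// !tmap_coord//.
pose G i j := tcoef h (chart_at (F p)) i j.
have Gs i j : smooth_at (F p) (G i j) by exact: smooth_tcoef.
have dG i j : dird (fun q => G i j (F q)) p (X p) =
    mval h (F p) (\sum_b comp p X b p *: Gamma (F p) b i) (E (F p) j)
    + mval h (F p) (E (F p) i) (\sum_b comp p X b p *: Gamma (F p) b j).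
  rewrite (dird_comp _ ac cp)//; [|exact: smF.1|by move=> l; exact: smooth_map_coordf].
  rewrite mval_suml mval_sumr -big_split; apply: eq_bigr => b _ /=.
  rewrite mvalZl mvalZr -mulrDr; congr (_ * _).
  rewrite -dird_coord_vf// /G tcoef.unlock.
  have := LC.2 _ _ _ _ (open_cdom (chart_at (F p))) (smooth_coord_vf b ac)
    (smooth_coord_vf i ac) (smooth_coord_vf j ac) (F p) cp.
  rewrite cov_tensorE => /eqP; rewrite subr_eq0 subr_eq => /eqP ->.
  by rewrite addrC.
rewrite (@dird_ext _ _ _ _ _ (fun q =>
  \sum_i \sum_j G i j (F q) * (comp p Y i q * comp p Z j q))); last first.
  apply: filterS (near_smooth_map smF (near_cdom cp)) => q cq.
  rewrite (mval_pullback smF) (mval_tcoef _ _ _ ac cq).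
  by apply: eq_bigr => i _; apply: eq_bigr => j _; rewrite !dird_tmap//; exact:
    smooth_at_coordf.
have GFs i j : smooth_at p (fun q => G i j (F q)) by exact: smooth_at_pull.
rewrite dird_sum; last first.
  by move=> i; apply: smooth_at_sum => j _; apply: smooth_atM => //; exact: smooth_atM.
rewrite !mval_suml -big_split; apply: eq_bigr => i _ /=.
rewrite dird_sum; last by move=> j; apply: smooth_atM => //; exact: smooth_atM.
rewrite !mval_sumr -big_split; apply: eq_bigr => j _ /=.
rewrite dirdM//; last exact: smooth_atM.
rewrite dirdM// dG !mvalDl !mvalDr !mvalZl !mvalZr /G -!tcoefE -/(E (F p) i) -/(E (F p) j).
by rewrite -/(comp p Y i p) -/(comp p Z j p); ring.
Qed.

(** The Christoffel terms cancel by symmetry, and what is left is the bracket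
    acting on the coordinate functions composed with [F]. *)
Lemma torsion_along p X Y : vf_at p X -> vf_at p Y ->
  nabla_along F D X Y p - nabla_along F D Y X p = tmap F p (lie X Y p).
Proof.
move=> Xs Ys; have ac := chart_at_atlas (F p); have cp := chart_at_dom (F p).
rewrite !nabla_alongE// tmap_coord//.
rewrite !big_split/= opprD addrACA.
have -> : \sum_i comp p Y i p *: (\sum_b comp p X b p *: Gamma (F p) b i)
    - \sum_i comp p X i p *: (\sum_b comp p Y b p *: Gamma (F p) b i) = 0.
  have -> : \sum_i comp p X i p *: (\sum_b comp p Y b p *: Gamma (F p) b i)
    = \sum_b \sum_i comp p X i p *: (comp p Y b p *: Gamma (F p) b i).
    by rewrite exchange_big/=; apply: eq_bigr => i _; rewrite scaler_sumr.
  rewrite -sumrB big1// => i _; rewrite scaler_sumr -sumrB big1// => b _.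
  rewrite !scalerA mulrC -scalerBr.
  have -> : Gamma (F p) b i - Gamma (F p) i b = 0.
    have := LC.1 _ _ _ (open_cdom (chart_at (F p))) (smooth_coord_vf b ac)
      (smooth_coord_vf i ac) (F p) cp.
    by rewrite lie_coord// => <-.
  by rewrite scaler0.
rewrite addr0 -sumrB; apply: eq_bigr => i _; rewrite -scalerBl; congr (_ *: _).
rewrite dird_lie//.
by apply: filterS (near_smooth_map smF (near_cdom cp)) => q cq; exact: smooth_map_coordf.
Qed.

Lemma koszul_along p X Y Z : vf_at p X -> vf_at p Y -> vf_at p Z ->
  2 * mval h (F p) (nabla_along F D X Y p) (tmap F p (Z p))
  = koszul (pullback F h) X Y Z p.
Proof.
move=> Xs Ys Zs; rewrite /koszul.
rewrite (metric_along X Ys Zs) (metric_along Y Xs Zs) (metric_along Z Xs Ys).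
move: (torsion_along Xs Ys) (torsion_along Xs Zs) (torsion_along Ys Zs) (mval_pullback smF h p).
have S u v := mvalC u v (symh (F p)).
move: (lie X Y p) (lie X Z p) (lie Y Z p) => a b c.
move: (nabla_along F D X Y p) (nabla_along F D Y X p) (nabla_along F D X Z p)
  (nabla_along F D Z X p) (nabla_along F D Y Z p) (nabla_along F D Z Y p).
move: (tmap F p) => t XY YX XZ ZX YZ ZY Ta Tb Tc P.
rewrite !P -Ta -Tb -Tc !mvalBl (S XZ) (S YZ) (S (t (X p)) ZY).
ring.
Qed.

Lemma pullback_sym p : (pullback F h p)^T = pullback F h p.
Proof. by apply/matrixP => i j; rewrite mxE [LHS]mxE [RHS]mxE; exact: bilC. Qed.

End Along.

Section Weyl.
Context {R : realType} {m : nat} {M : manifold R m}.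
Context {g : tensor02 M} {D : connection M} {theta : oneform M}.
Hypotheses (symg : forall y, (g y)^T = g y) (TF : torsion_free D)
  (CF : conformal_with D g theta).

(** The classical computation, with an additional term in theta for each of the
    three derivatives of [g]. *)
Lemma koszul_weyl (U : set M) (X Y Z : vfield M) p : open U -> smooth_vf U X -> smooth_vf U Y ->
  smooth_vf U Z -> U p ->
  koszul g X Y Z p = 2 * mval g p (D X Y p) (Z p)
  + form_app (theta p) (X p) * mval g p (Y p) (Z p)
  + form_app (theta p) (Y p) * mval g p (X p) (Z p)
  - form_app (theta p) (Z p) * mval g p (X p) (Y p).
Proof.
move=> oU Xs Ys Zs Up.
have C A B C : smooth_vf U A -> smooth_vf U B -> smooth_vf U C ->
  dird (fun q => mval g q (B q) (C q)) p (A p) = form_app (theta p) (A p) * mval g p (B p) (C p)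
    + mval g p (D A B p) (C p) + mval g p (D A C p) (B p).
  move=> As Bs Cs; have := CF oU As Bs Cs Up; rewrite (mvalE g p) cov_tensorE => <-.
  rewrite (mvalC (B p) (D A C p))//.
  ring.
rewrite /koszul !C//.
move: (TF oU Xs Ys Up) (TF oU Xs Zs Up) (TF oU Ys Zs Up).
move: (lie X Y p) (lie X Z p) (lie Y Z p) => a b c <- <- <-.
by rewrite !mvalBl; ring.
Qed.

End Weyl.

(** * A Weyl connection implies umbilicity *)

Section Umbilical.
Context {R : realType} {n : nat} {M : manifold R n.+1} {N : manifold R n.+2}.
Context {gbar : tensor02 N} {Dbar : connection N} {iota : M -> N}.
Hypotheses (smi : smooth_map iota) (smg : smooth_tensor02 gbar)
  (symg : forall y, (gbar y)^T = gbar y) (LC : levi_civita gbar Dbar).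

Lemma normal_pullback p u v : normal_at iota gbar p (tmap iota p v) ->
  mval (pullback iota gbar) p u v = 0.
Proof.
move=> H; rewrite (mval_pullback smi) mvalC// -(mvalE gbar (iota p)); exact: H.
Qed.

(** For a normal field xi the Koszul formula of the ambient connection gives
    [2 B(X, Y)], and that of a Weyl connection gives [- theta(xi) g(X, Y)]. *)
Lemma weyl_umbilical (D : connection M) : weyl_connection (pullback iota gbar) D ->
  totally_umbilical iota gbar Dbar.
Proof.
move=> [TF [theta [ths CF]]] c ac xi [xis xin].
exists (fun p => - 2^-1 * form_app (theta p) (xi p)); split.
  have /smooth_funP H := ths _ xi (open_cdom c) xis.
  apply/smooth_funP; first exact: open_cdom.
  move=> p cp; apply: smooth_atM; first exact: smooth_at_cst.
  by apply: H => //; exact: open_cdom.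
move=> X Y Xs Ys p cp.
have V Z : smooth_vf (cdom c) Z -> vf_at p Z.
  by move=> /smooth_vfP; apply=> //; exact: open_cdom.
have K := koszul_along smi smg symg LC (V _ Xs) (V _ Ys) (V _ xis).
have symp := pullback_sym (F := iota) symg.
rewrite (koszul_weyl symp TF CF (open_cdom c) Xs Ys xis cp) in K.
have Z u : mval (pullback iota gbar) p u (xi p) = 0.
  by apply: normal_pullback; have [] := xin p cp.
rewrite !Z !mulr0 !add0r in K.
rewrite /second_form (mvalE gbar (iota p)) (mvalE (pullback iota gbar) p).
have two : (2 : R) != 0 by rewrite pnatr_eq0.
apply: (mulfI two); by rewrite K -mulrA mulNr mulrN mulVKf.
Qed.

End Umbilical.

(** * Bump functions on a manifold *)

Section BumpManifold.
Context {R : realType} {m : nat} {M : manifold R m}.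
Implicit Types (p q : M).

(** The closed coordinate box is compact, so its image is closed in the
    Hausdorff space M; hence the bump of the chart, extended by 0, is smooth. *)
Lemma bump_on_manifold p0 (V : set M) : open V -> V p0 ->
  exists b : M -> R, [/\ forall p, smooth_at p b, \forall q \near p0, b q = 1
    & forall p, ~ V p -> \forall q \near p, b q = 0].
Proof.
move=> oV Vp0; have ac := chart_at_atlas p0; have cp := chart_at_dom p0.
move: (chart_at p0) ac cp => c ac cp.
have oW : open (c @` (V `&` cdom c)) by exact: open_chart_image.
have Wp : (c @` (V `&` cdom c)) (c p0) by exists p0.
have /nbhs_ballP[e /= e0 eW] := open_nbhs_nbhs (conj oW Wp).
pose r := e / 2; have r0 : 0 < r by rewrite divr_gt0.
have [b [bs b1 b0]] := bump_exists (c p0) r0.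
pose K0 : set 'rV[R]_m := [set x | forall i, `[c p0 0 i - r, c p0 0 i + r]%classic (x 0 i)].
have K0P x : K0 x <-> `|x - c p0| <= r.
  split=> [K0x|xr i]; last first.
    have := le_trans (norm_coord_le (x - c p0) i) xr.
    by rewrite !mxE ler_distl /= in_itv.
  apply: norm_le_coord (ltW r0) _ => i; have := K0x i.
  by rewrite !mxE ler_distl /= in_itv.
have K0W : K0 `<=` c @` (V `&` cdom c).
  move=> x /K0P xr; apply: eW; rewrite -ball_normE /= distrC.
  by apply: le_lt_trans xr _; rewrite /r ltr_pdivrMr// ltr_pMr// ltr1n.
have cK0 : compact K0.
  by apply: (@rV_compact _ _ (fun i => `[c p0 0 i - r, c p0 0 i + r]%classic)) => i; exact:
    segment_compact.
have clK : closed (cinv c @` K0).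
  apply: compact_closed; first exact: mhausdorff.
  apply: continuous_compact => //; apply: continuous_in_subspaceT => x /set_mem /K0W Wx.
  by apply: cinv_cont; case: Wx => q [_ cq] <-; exists q.
have KV : cinv c @` K0 `<=` V `&` cdom c.
  by move=> _ [x /K0W [q [Vq cq] <-] <-]; rewrite cmapK.
pose beta q := if `[< cdom c q >] then b (c q) else 0.
have beta_c q : cdom c q -> beta q = b (c q) by move=> cq; rewrite /beta asboolT.
have beta0 q : ~ (cinv c @` K0) q -> \forall q' \near q, beta q' = 0.
  move=> Kq; have N : nbhs q (~` (cinv c @` K0)).
    by apply: open_nbhs_nbhs; split=> //; exact: closed_openC.
  apply: filterS N => q' Kq'; rewrite /beta; case: asboolP => // cq'.
  apply: b0; rewrite ltNge; apply/negP => /K0P K0q'; apply: Kq'.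
  by exists (c q') => //; rewrite cmapK.
have betan q : cdom c q -> \forall q' \near q, b (c q') = beta q'.
  by move=> cq; apply: filterS (near_cdom cq) => q' cq'; rewrite beta_c.
exists beta; split.
- move=> p; have [cp'|ncp] := pselect (cdom c p).
    exact: smooth_at_ext (betan p cp') (smooth_at_comp_chart ac cp' (bs (c p))).
  apply: smooth_at_ext (smooth_at_cst p 0).
  have : ~ (cinv c @` K0) p by move=> /KV [].
  by move=> /beta0; apply: filterS => q ->.
- have := near_and (near_cdom cp) (near_chart_pull cp b1).
  by apply: filterS => q [cq E]; rewrite beta_c.
- by move=> p nVp; apply: beta0 => /KV [].
Qed.

End BumpManifold.

(** * Weighted Weyl structures *)

(** A Weyl structure of weight [b]: an operator that behaves as [b] times a
    torsion-free connection satisfying nabla g = theta (x) g. Sums of such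
    structures add their weights, and the structures of weight 1 are the Weyl
    connections. *)
Record weighted_weyl_at (R : realType) (m : nat) (M : manifold R m) (g : tensor02 M)
  (b : M -> R) (T : vfield M -> vfield M -> vfield M) (theta : oneform M) (p : M) : Prop :=
    WeightedWeyl {
  ww_weight : smooth_at p b;
  ww_smooth : forall (U : set M) X Y, open U -> smooth_vf U X -> smooth_vf U Y -> U p ->
    vf_at p (T X Y);
  ww_local : forall (U : set M) X X' Y Y', open U -> smooth_vf U X -> smooth_vf U Y ->
    (forall q, U q -> X q = X' q) -> (forall q, U q -> Y q = Y' q) -> U p ->
    T X Y p = T X' Y' p;
  wwDl : forall (U : set M) X X' Y, open U -> smooth_vf U X -> smooth_vf U X' ->
    smooth_vf U Y -> U p -> T (fun q => X q + X' q) Y p = T X Y p + T X' Y p;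
  wwZl : forall (U : set M) (f : M -> R) X Y, open U -> smooth_fun U f -> smooth_vf U X ->
    smooth_vf U Y -> U p -> T (fun q => f q *: X q) Y p = f p *: T X Y p;
  wwDr : forall (U : set M) X Y Y', open U -> smooth_vf U X -> smooth_vf U Y ->
    smooth_vf U Y' -> U p -> T X (fun q => Y q + Y' q) p = T X Y p + T X Y' p;
  ww_leibniz : forall (U : set M) (f : M -> R) X Y, open U -> smooth_fun U f ->
    smooth_vf U X -> smooth_vf U Y -> U p ->
    T X (fun q => f q *: Y q) p = (b p * dird f p (X p)) *: Y p + f p *: T X Y p;
  ww_torsion : forall (U : set M) X Y, open U -> smooth_vf U X -> smooth_vf U Y -> U p ->
    T X Y p - T Y X p = b p *: lie X Y p;
  ww_form : forall (U : set M) X, open U -> smooth_vf U X -> U p ->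
    smooth_at p (fun q => form_app (theta q) (X q));
  ww_conformal : forall (U : set M) X Y Z, open U -> smooth_vf U X -> smooth_vf U Y ->
    smooth_vf U Z -> U p ->
    b p * dird (fun q => mval g q (Y q) (Z q)) p (X p) - mval g p (T X Y p) (Z p) - mval g p
      (Y p) (T X Z p)
    = form_app (theta p) (X p) * mval g p (Y p) (Z p) }.

Section FormApp.
Context {R : realType} {m : nat}.
Implicit Types (t : 'cV[R]_m) (v : 'rV[R]_m).

Lemma form_appD t t' v : form_app (t + t') v = form_app t v + form_app t' v.
Proof. by rewrite /form_app mulmxDr mxE. Qed.

Lemma form_appZ a t v : form_app (a *: t) v = a * form_app t v.
Proof. by rewrite /form_app -scalemxAr mxE. Qed.

Lemma form_app0 v : form_app 0 v = 0.
Proof. by rewrite /form_app mulmx0 mxE. Qed.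

End FormApp.

Section Weighted.
Context {R : realType} {m : nat} {M : manifold R m} {g : tensor02 M}.
Implicit Types (p q : M) (b : M -> R) (T : vfield M -> vfield M -> vfield M) (th : oneform M).

Lemma smooth_vf_at (U : set M) X p : open U -> smooth_vf U X -> U p -> vf_at p X.
Proof. by move=> oU /(smooth_vfP _ oU); apply. Qed.

Lemma smooth_fun_at (U : set M) (f : M -> R) p : open U -> smooth_fun U f -> U p ->
  smooth_at p f.
Proof. by move=> oU /(smooth_funP _ oU); apply. Qed.

Lemma weighted_weyl_ext b b' T T' th th' p :
  (\forall q \near p, b q = b' q /\ (forall X Y, T X Y q = T' X Y q) /\ th q = th' q) ->
  weighted_weyl_at g b T th p -> weighted_weyl_at g b' T' th' p.
Proof.
move=> N W; have [Eb [ET Eth]] := nbhs_singleton N; split.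
- by apply: smooth_at_ext (ww_weight W); apply: filterS N => q [].
- move=> U X Y oU Xs Ys Up; apply: vf_at_ext (ww_smooth W oU Xs Ys Up).
  by apply: filterS N => q [_ []].
- by move=> U X X' Y Y' oU Xs Ys EX EY Up; rewrite -!ET (ww_local W oU Xs Ys EX EY Up).
- by move=> U X X' Y oU Xs Xs' Ys Up; rewrite -!ET (wwDl W oU Xs Xs' Ys Up).
- by move=> U f X Y oU fs Xs Ys Up; rewrite -!ET (wwZl W oU fs Xs Ys Up).
- by move=> U X Y Y' oU Xs Ys Ys' Up; rewrite -!ET (wwDr W oU Xs Ys Ys' Up).
- by move=> U f X Y oU fs Xs Ys Up; rewrite -!ET -Eb (ww_leibniz W oU fs Xs Ys Up).
- by move=> U X Y oU Xs Ys Up; rewrite -!ET -Eb (ww_torsion W oU Xs Ys Up).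
- move=> U X oU Xs Up; apply: smooth_at_ext (ww_form W oU Xs Up).
  by apply: filterS N => q [_ [_ ->]].
- by move=> U X Y Z oU Xs Ys Zs Up; rewrite -!ET -Eb -Eth (ww_conformal W oU Xs Ys Zs Up).
Qed.

Lemma weighted_weyl0 p : weighted_weyl_at g (fun=> 0) (fun _ _ _ => 0) (fun=> 0) p.
Proof.
split.
- exact: smooth_at_cst.
- by move=> *; exact: vf_at_cst0.
- by [].
- by move=> *; rewrite addr0.
- by move=> *; rewrite scaler0.
- by move=> *; rewrite addr0.
- by move=> *; rewrite mul0r scale0r scaler0 addr0.
- by move=> *; rewrite scale0r subrr.
- move=> *; apply: smooth_at_ext (smooth_at_cst p 0).
  by apply: near_everywhere => q; rewrite form_app0.
- by move=> *; rewrite form_app0 !mul0r mval.unlock bil0l bil0r !subr0.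
Qed.

Lemma weighted_weylD b b' T T' th th' p :
  weighted_weyl_at g b T th p -> weighted_weyl_at g b' T' th' p ->
  weighted_weyl_at g (fun q => b q + b' q) (fun X Y q => T X Y q + T' X Y q)
    (fun q => th q + th' q) p.
Proof.
move=> W W'; split.
- exact: smooth_atD (ww_weight W) (ww_weight W').
- by move=> U X Y oU Xs Ys Up; apply: vf_atD;
  [exact: (ww_smooth W oU Xs Ys Up)|exact: (ww_smooth W' oU Xs Ys Up)].
- move=> U X X' Y Y' oU Xs Ys EX EY Up.
  by rewrite (ww_local W oU Xs Ys EX EY Up) (ww_local W' oU Xs Ys EX EY Up).
- move=> U X X' Y oU Xs Xs' Ys Up.
  by rewrite (wwDl W oU Xs Xs' Ys Up) (wwDl W' oU Xs Xs' Ys Up) addrACA.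
- move=> U f X Y oU fs Xs Ys Up.
  by rewrite (wwZl W oU fs Xs Ys Up) (wwZl W' oU fs Xs Ys Up) scalerDr.
- move=> U X Y Y' oU Xs Ys Ys' Up.
  by rewrite (wwDr W oU Xs Ys Ys' Up) (wwDr W' oU Xs Ys Ys' Up) addrACA.
- move=> U f X Y oU fs Xs Ys Up.
  rewrite (ww_leibniz W oU fs Xs Ys Up) (ww_leibniz W' oU fs Xs Ys Up).
  by rewrite addrACA mulrDl scalerDl scalerDr.
- move=> U X Y oU Xs Ys Up.
  by rewrite opprD addrACA (ww_torsion W oU Xs Ys Up) (ww_torsion W' oU Xs Ys Up) scalerDl.
- move=> U X oU Xs Up.
  apply: smooth_at_ext (smooth_atD (ww_form W oU Xs Up) (ww_form W' oU Xs Up)).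
  by apply: near_everywhere => q; rewrite form_appD.
- move=> U X Y Z oU Xs Ys Zs Up; rewrite form_appD [RHS]mulrDl.
  rewrite -(ww_conformal W oU Xs Ys Zs Up) -(ww_conformal W' oU Xs Ys Zs Up).
  by rewrite mvalDl mvalDr; ring.
Qed.

Lemma weighted_weylZ f b T th p : smooth_at p f ->
  weighted_weyl_at g b T th p ->
  weighted_weyl_at g (fun q => f q * b q) (fun X Y q => f q *: T X Y q)
    (fun q => f q *: th q) p.
Proof.
move=> fs W; split.
- exact: smooth_atM fs (ww_weight W).
- by move=> U X Y oU Xs Ys Up; apply: vf_atZ => //; exact: (ww_smooth W oU Xs Ys Up).
- by move=> U X X' Y Y' oU Xs Ys EX EY Up; rewrite (ww_local W oU Xs Ys EX EY Up).
- by move=> U X X' Y oU Xs Xs' Ys Up; rewrite (wwDl W oU Xs Xs' Ys Up) scalerDr.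
- by move=> U h X Y oU hs Xs Ys Up; rewrite (wwZl W oU hs Xs Ys Up) !scalerA mulrC.
- by move=> U X Y Y' oU Xs Ys Ys' Up; rewrite (wwDr W oU Xs Ys Ys' Up) scalerDr.
- move=> U h X Y oU hs Xs Ys Up.
  by rewrite (ww_leibniz W oU hs Xs Ys Up) scalerDr !scalerA mulrA (mulrC (h p)).
- by move=> U X Y oU Xs Ys Up; rewrite -scalerBr (ww_torsion W oU Xs Ys Up) scalerA.
- move=> U X oU Xs Up; apply: smooth_at_ext (smooth_atM fs (ww_form W oU Xs Up)).
  by apply: near_everywhere => q; rewrite form_appZ.
- move=> U X Y Z oU Xs Ys Zs Up; rewrite form_appZ -[RHS]mulrA.
  rewrite -(ww_conformal W oU Xs Ys Zs Up).
  by rewrite mvalZl mvalZr; ring.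
Qed.

(** Outside V the bump function vanishes locally, so the product of the
    structure with it coincides there with the zero structure. *)
Lemma weighted_weyl_extend (V : set M) p0 T th : open V -> V p0 ->
  (forall p, V p -> weighted_weyl_at g (fun=> 1) T th p) ->
  exists b T' th', (forall p, weighted_weyl_at g b T' th' p) /\ \forall q \near p0, b q = 1.
Proof.
move=> oV Vp0 W; have [b [bs b1 b0]] := bump_on_manifold oV Vp0.
exists b, (fun X Y q => b q *: T X Y q), (fun q => b q *: th q); split=> // p.
have [Vp|nVp] := pselect (V p).
  apply: weighted_weyl_ext (weighted_weylZ (bs p) (W p Vp)).
  by apply: near_everywhere => q; rewrite mulr1.
apply: weighted_weyl_ext (weighted_weyl0 p).
by apply: filterS (b0 p nVp) => q ->; split=> //; split=> [X Y|]; rewrite scale0r.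
Qed.

End Weighted.

(** * Gluing *)

Section Gluing.
Context {R : realType} {m : nat} {M : manifold R m} {g : tensor02 M}.

Let wdata : Type := ((M -> R) * (vfield M -> vfield M -> vfield M) * oneform M)%type.
Let ok (w : wdata) := forall p, weighted_weyl_at g w.1.1 w.1.2 w.2 p.
Let zero : wdata := ((fun=> 0), (fun _ _ _ => 0), (fun=> 0)).

(** For each member of a countable basis on which some structure has weight 1,
    one such structure is kept; the other indices receive the zero structure. *)
Lemma countable_weyl_cover :
  (forall p0 : M, exists w : wdata, ok w /\ \forall q \near p0, w.1.1 q = 1) ->
  exists e : nat -> wdata, (forall i, ok (e i)) /\
    forall p0 : M, exists i, \forall q \near p0, (e i).1.1 q = 1.
Proof.
move=> H; have [B /countable_injP[f finj] [oB bB]] := @msecond_countable _ _ M.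
have /choice[e eP] : forall i : nat, exists w : wdata, ok w /\ forall A, B A -> f A = i ->
    (exists w', ok w' /\ forall q, A q -> w'.1.1 q = 1) -> forall q, A q -> w.1.1 q = 1.
  move=> i; have [[A [BA [fA [w' [okw' w'1]]]]]|no] := pselect (exists A, B A /\ f A = i /\
     exists w', ok w' /\ forall q, A q -> w'.1.1 q = 1).
    exists w'; split=> // A' BA' fA' _.
    by have -> : A' = A by apply: finj; rewrite ?inE// fA' fA.
  exists zero; split; first by move=> p; exact: weighted_weyl0.
  by move=> A BA fA ex; exfalso; apply: no; exists A.
exists e; split=> [i|p0]; first by have [] := eP i.
have [w [okw w1]] := H p0.
have [A [BA Ap0] sA] := bB p0 _ w1.
exists (f A); have [_ /(_ A BA erefl) E] := eP (f A).
have NA : nbhs p0 A by apply: open_nbhs_nbhs; split=> //; exact: oB.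
by apply: filterS NA; apply: E; exists w.
Qed.

(** The recursion S_{i+1} = S_i + (1 - w_i) e_i, with w_i the weight of S_i:
    as 1 - w_{i+1} = (1 - w_i)(1 - b_i), the sequence becomes stationary
    wherever one of the bumps b_i equals 1, so no locally finite refinement is
    needed. *)
Let step (s e : wdata) : wdata :=
  ((fun q => s.1.1 q + (1 - s.1.1 q) * e.1.1 q),
   (fun X Y q => s.1.2 X Y q + (1 - s.1.1 q) *: e.1.2 X Y q),
   (fun q => s.2 q + (1 - s.1.1 q) *: e.2 q)).

Lemma weighted_weyl_glue :
  (forall p0 : M, exists w : wdata, ok w /\ \forall q \near p0, w.1.1 q = 1) ->
  exists T th, forall p, weighted_weyl_at g (fun=> 1) T th p.
Proof.
move=> /countable_weyl_cover[e [eok e1]].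
pose S := fix S i := if i is j.+1 then step (S j) (e j) else zero.
have Sok i : ok (S i).
  elim: i => [|i IH] p /=; first exact: weighted_weyl0.
  apply: weighted_weylD (IH p) _; apply: weighted_weylZ; last exact: eok.
  apply: smooth_atB; first exact: smooth_at_cst.
  exact: ww_weight (IH p).
have stat q i j : (i <= j)%N -> (S i).1.1 q = 1 ->
    [/\ (S j).1.1 q = 1, forall X Y, (S j).1.2 X Y q = (S i).1.2 X Y q & (S j).2 q = (S i).2 q].
  move=> /subnK <-; elim: (j - i)%N => [//|d IH] /[dup] w1 /IH [E1 E2 E3] /=.
  rewrite E1 subrr; split; first by rewrite mul0r addr0.
    by move=> X Y; rewrite scale0r addr0 E2.
  by rewrite scale0r addr0 E3.
have ex q : exists i, (S i).1.1 q = 1.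
  have [i /nbhs_singleton E] := e1 q; exists i.+1.
  by rewrite /= E mulr1 addrC subrK.
have [Nx NP] := choice ex.
exists (fun X Y q => (S (Nx q)).1.2 X Y q), (fun q => (S (Nx q)).2 q) => p.
have [i ei] := e1 p.
apply: weighted_weyl_ext (Sok i.+1 p).
apply: filterS ei => q E.
have w1 : (S i.+1).1.1 q = 1 by rewrite /= E mulr1 addrC subrK.
split=> //.
have [le|/ltnW le] := leqP i.+1 (Nx q).
  by have [_ E2 E3] := stat q _ _ le w1; split=> [X Y|].
by have [_ E2 E3] := stat q _ _ le (NP q); split=> [X Y|].
Qed.

Lemma weyl_of_weighted T th : (forall p, weighted_weyl_at g (fun=> 1) T th p) ->
  exists D : connection M, weyl_connection g D.
Proof.
move=> W.
have sm (U : set M) X Y : open U -> smooth_vf U X -> smooth_vf U Y -> smooth_vf U (T X Y).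
  move=> oU Xs Ys; apply/smooth_vfP => // p Up.
  exact: (ww_smooth (W p) oU Xs Ys Up).
pose D : connection M := @Connection R m M T sm
  (fun U X X' Y Y' oU Xs Ys EX EY p Up => ww_local (W p) oU Xs Ys EX EY Up)
  (fun U X X' Y oU Xs Xs' Ys p Up => wwDl (W p) oU Xs Xs' Ys Up)
  (fun U f X Y oU fs Xs Ys p Up => wwZl (W p) oU fs Xs Ys Up)
  (fun U X Y Y' oU Xs Ys Ys' p Up => wwDr (W p) oU Xs Ys Ys' Up)
  (fun U f X Y oU fs Xs Ys p Up => etrans (ww_leibniz (W p) oU fs Xs Ys Up)
     (congr1 (fun a => a *: Y p + f p *: T X Y p) (etrans (mul1r _) (esym (dirdE p f (X p)))))).
exists D; split.
  by move=> U X Y oU Xs Ys p Up; rewrite (ww_torsion (W p) oU Xs Ys Up) scale1r.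
exists th; split=> [U X oU Xs|U X Y Z oU Xs Ys Zs p Up].
  by apply/smooth_funP => // p Up; exact: (ww_form (W p) oU Xs Up).
by rewrite cov_tensorE (mvalE g p) -(ww_conformal (W p) oU Xs Ys Zs Up) mul1r.
Qed.

End Gluing.

(** * Symmetric matrices of corank one *)

Section CorankOne.
Context {F : fieldType} {n : nat}.
Implicit Types (G : 'M[F]_n.+1) (u v w : 'rV[F]_n.+1) (a : 'I_n.+1).

(** For a suitable index [a] this is invertible although [G] is not. Its inverse
    yields, by expressions rational in the entries of [G], a kernel vector of [G]
    ([completed_mx_kernel]) and solutions of [v *m G = w]
    ([completed_mx_solve]); these therefore depend smoothly on [G]. *)
Definition completed_mx G a := G + delta_mx a a.

Lemma mul_completed_mx u G a : u *m completed_mx G a = u *m G + u 0 a *: delta_mx 0 a.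
Proof.
rewrite /completed_mx mulmxDr; congr (_ + _); apply/rowP => j; rewrite !mxE.
rewrite (bigD1 a)//= big1 => [|i ia]; last by rewrite !mxE (negbTE ia) mulr0.
by rewrite !mxE !eqxx addr0.
Qed.

Lemma corank1_kernel G : \rank G = n -> exists2 v : 'rV_n.+1, v != 0 & v *m G = 0.
Proof.
move=> rG; have : kermx G != 0.
  by rewrite -mxrank_eq0 mxrank_ker rG subSn// subnn.
move=> /rowV0Pn[v /sub_kermxP vG v0]; by exists v.
Qed.

Lemma corank1_kernel_line G v u : \rank G = n -> v != 0 -> v *m G = 0 -> u *m G = 0 ->
  exists k, u = k *: v.
Proof.
move=> rG v0 /sub_kermxP vG /sub_kermxP uG.
have rK : \rank (kermx G) = 1%N by rewrite mxrank_ker rG subSn// subnn.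
have rv : \rank v = 1%N by rewrite rank_rV v0.
have := mxrank_leqif_sup vG; rewrite rv rK => /leqif_refl Kv.
by apply/sub_rVP; exact: submx_trans uG Kv.
Qed.

(** If u is killed by G + E_aa, pairing u G = - u_a e_a with the kernel vector v
    gives u_a v_a = 0, so u_a = 0 and u is a multiple of v with zero a-th entry. *)
Lemma completed_mx_unit G v a : G^T = G -> \rank G = n -> v *m G = 0 -> v 0 a != 0 ->
  completed_mx G a \in unitmx.
Proof.
move=> sG rG vG va; have v0 : v != 0 by apply: contraNneq va => ->; rewrite mxE.
rewrite -row_free_unit -kermx_eq0; apply/rowV0P => u /sub_kermxP.
rewrite mul_completed_mx => uE.
have vGT : G *m v^T = 0 by rewrite -[G]sG -trmx_mul vG trmx0.
have ua : u 0 a = 0.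
  have : (u *m G + u 0 a *: delta_mx 0 a) *m v^T = 0 by rewrite uE mul0mx.
  rewrite mulmxDl -mulmxA vGT mulmx0 add0r -scalemxAl -rowE => /matrixP/(_ 0 0).
  by rewrite !mxE => /eqP; rewrite mulf_eq0 (negbTE va) orbF => /eqP.
rewrite ua scale0r addr0 in uE.
have [k uk] := corank1_kernel_line rG v0 vG uE.
move: ua; rewrite uk mxE => /eqP; rewrite mulf_eq0 (negbTE va) orbF => /eqP ->.
by rewrite scale0r.
Qed.

Lemma completed_mx_kernel G a : \rank G = n -> completed_mx G a \in unitmx ->
  row a (invmx (completed_mx G a)) *m G = 0 /\ row a (invmx (completed_mx G a)) 0 a = 1.
Proof.
move=> rG uG; have [v v0 vG] := corank1_kernel rG.
have E := mul_completed_mx v G a; rewrite vG add0r in E.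
have vI : v = v 0 a *: row a (invmx (completed_mx G a)).
  by rewrite rowE scalemxAl -E mulmxK.
have va : v 0 a != 0 by apply: contraNneq v0 => va; rewrite vI va scale0r.
split; first by apply: (scalerI va); rewrite scalemxAl -vI vG scaler0.
by have /matrixP/(_ 0 a) := vI; rewrite [RHS]mxE => /esym; rewrite -[RHS]mulr1 => /(mulfI va).
Qed.

(** The solution u of u (G + E_aa) = w satisfies u_a = 0, by pairing with the
    kernel vector. *)
Lemma completed_mx_solve G a w : G^T = G -> \rank G = n -> completed_mx G a \in unitmx ->
  w *m (row a (invmx (completed_mx G a)))^T = 0 -> w *m invmx (completed_mx G a) *m G = w.
Proof.
move=> sG rG uG wv; have [vG va] := completed_mx_kernel rG uG.
move: (row a _) vG va wv => v vG va wv; set u := w *m _.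
have E : u *m G + u 0 a *: delta_mx 0 a = w by rewrite -mul_completed_mx mulmxKV.
have vGT : G *m v^T = 0 by rewrite -[G]sG -trmx_mul vG trmx0.
have ua : u 0 a = 0.
  move: wv; rewrite -E mulmxDl -mulmxA vGT mulmx0 add0r -scalemxAl -rowE.
  by move=> /matrixP/(_ 0 0); rewrite !mxE va mulr1.
by rewrite -[RHS]E ua scale0r addr0.
Qed.

End CorankOne.

(** * Smooth matrices *)

Section SmoothMatrix.
Context {R : realType} {m : nat} {M : manifold R m}.
Implicit Types (p q : M).

Lemma smooth_at_det n (A : M -> 'M[R]_n) p : (forall i j, smooth_at p (fun q => A q i j)) ->
  smooth_at p (fun q => \det (A q)).
Proof.
move=> As; apply: smooth_at_sum => s _; apply: smooth_atM; first exact: smooth_at_cst.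
by apply: smooth_at_prod => i _; exact: As.
Qed.

Lemma smooth_at_invmx n (A : M -> 'M[R]_n) p : (forall i j, smooth_at p (fun q => A q i j)) ->
  (\forall q \near p, A q \in unitmx) -> forall i j, smooth_at p (fun q => invmx (A q) i j).
Proof.
move=> As uA i j.
apply: (@smooth_at_ext _ _ _ _ (fun q =>
  (\det (A q))^-1 * ((-1) ^+ (j + i) * \det (row' j (col' i (A q)))))).
  by apply: filterS uA => q uq; rewrite /invmx uq !mxE /cofactor.
apply: smooth_atM.
  apply: smooth_atV; last exact: smooth_at_det.
  by rewrite -unitfE -unitmxE; exact: nbhs_singleton uA.
apply: smooth_atM; first exact: smooth_at_cst.
apply: smooth_at_det => k l.
by apply: smooth_at_ext (As (lift j k) (lift i l)); apply: near_everywhere => q; rewrite !mxE.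
Qed.

Lemma smooth_at_continuous (f : M -> R) p : smooth_at p f -> {for p, continuous f}.
Proof.
move=> [c [ac cp fs]].
have cf : {for c p, continuous (f \o cinv c)} := nbhs_singleton (Cgerm_continuous (fs 0%N)).
apply: (@continuous_near_eq _ _ ((f \o cinv c) \o c)).
  by apply: filterS (near_cdom cp) => q cq /=; rewrite cmapK.
by apply: continuous_comp => //; exact: cmap_cont.
Qed.

End SmoothMatrix.

(** * Restriction of charts *)

Section Restriction.
Context {R : realType} {m : nat} {M : manifold R m}.
Context (c : chart R M m) {V : set M}.
Hypotheses (oV : open V) (sV : V `<=` cdom c).

Let oimg : open (c @` V).
Proof. by have := open_chart_image (c := c) oV; rewrite setIidl. Qed.

(** Umbilicity is a condition on charts that carry a normal field defined on
    the whole chart domain; such charts are obtained by shrinking, and belong to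
    the maximal atlas. *)
Definition restrict_chart : chart R M m := @Chart R M m c V (cinv c) oV oimg
  (fun p Vp => cmapK (sV Vp)) (fun p Vp => cmap_cont (sV Vp))
  (fun x Vx => @cinv_cont _ _ _ c x (image_subset c sV x Vx)).

Lemma smooth_on_sub k (A B : set 'rV[R]_k) f : A `<=` B -> smooth_on B f -> smooth_on A f.
Proof.
move=> AB Bf j; move: (Bf j) => {Bf}; elim: j f => [|j IH] f /= [cf df].
  by split=> // x /AB /cf.
split=> [x /AB /cf//|i]; have [d1 /IH d2] := df i; split=> // x /AB; exact: d1.
Qed.

Lemma restrict_chart_atlas : atlas M c -> atlas M restrict_chart.
Proof.
move=> ac; apply: atlas_max => d ad; split=> j.
- apply: smooth_on_sub (atlas_compat ac ad j) => _ [q [Vq dq] <-].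
  by exists q => //; split=> //; exact: sV.
- apply: smooth_on_sub (atlas_compat ad ac j) => _ [q [dq Vq] <-].
  by exists q => //; split=> //; exact: sV.
Qed.

End Restriction.

(** * A connection with prescribed Christoffel fields *)

Section LocalConnection.
Context {R : realType} {m : nat} {M : manifold R m} {g : tensor02 M}.
Context (c : chart R M m) {V : set M} (Gam : 'I_m -> 'I_m -> vfield M) (t : 'I_m -> M -> R).
Hypotheses (smg : smooth_tensor02 g) (ac : atlas M c) (oV : open V) (sV : V `<=` cdom c).
Hypotheses (Gams : forall i j p, V p -> vf_at p (Gam i j))
  (Gamsym : forall i j p, V p -> Gam i j p = Gam j i p)
  (ts : forall i p, V p -> smooth_at p (t i))
  (Gamg : forall i j l p, V p -> partial c i (tcoef g c j l) p =
     mval g p (Gam i j p) (coord_vf c l p) + mval g p (coord_vf c j p) (Gam i l p)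
     + t i p * tcoef g c j l p).
Implicit Types (p q : M) (X Y Z : vfield M).

Let comp X i q : R := dird (coordf c i) q (X q).
Let GamX X p j := \sum_i comp X i p *: Gam i j p.

(** Here [Gam i j] stands for the covariant derivative of d_j along d_i, and [t]
    for the components of theta. *)
Definition local_nabla X Y p : 'rV[R]_m :=
  \sum_j (dird (comp Y j) p (X p) *: coord_vf c j p + comp Y j p *: GamX X p j).

Definition local_form p : 'cV[R]_m :=
  \col_j \sum_i t i p * dird (coordf c i) p (delta_mx 0 j).

Let compD X Y i q : V q -> comp (fun q => X q + Y q) i q = comp X i q + comp Y i q.
Proof. by move=> Vq; rewrite /comp dird_coordfD//; exact: sV. Qed.

Let compZ f X i q : V q -> comp (fun q => f q *: X q) i q = f q * comp X i q.
Proof. by move=> Vq; rewrite /comp dird_coordfZ//; exact: sV. Qed.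

Let near_V p : V p -> \forall q \near p, V q.
Proof. by move=> Vp; exact: open_nbhs_nbhs. Qed.

Let comp_smooth X i p : V p -> vf_at p X -> smooth_at p (comp X i).
Proof. by move=> Vp /(vf_atP _ ac (sV Vp)); exact. Qed.

Let comp_near U X i p : open U -> smooth_vf U X -> U p -> V p ->
  \forall q \near p, smooth_at q (comp X i).
Proof.
move=> oU Xs Up Vp; have NU : \forall q \near p, U q by exact: open_nbhs_nbhs.
apply: filterS (near_and NU (near_V Vp)) => q [Uq Vq].
exact: comp_smooth Vq (smooth_vf_at oU Xs Uq).
Qed.

Lemma local_form_app p v : V p -> form_app (local_form p) v =
  \sum_i t i p * dird (coordf c i) p v.
Proof.
move=> Vp; rewrite /form_app mxE.
transitivity (\sum_j \sum_i t i p * (v 0 j * dird (coordf c i) p (delta_mx 0 j))).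
  apply: eq_bigr => j _; rewrite mxE mulr_sumr; apply: eq_bigr => i _; ring.
rewrite exchange_big; apply: eq_bigr => i _; rewrite -mulr_sumr; congr (_ * _).
have S : smooth_at p (coordf c i) by apply: smooth_at_coordf => //; exact: sV.
rewrite [v in RHS]row_sum_delta.
by rewrite dird_vec_sum//; apply: eq_bigr => j _; rewrite dird_vecZ.
Qed.

(** Each property holds for the coordinate fields by hypothesis, and passes to
    combinations of them by the product rule. *)
Lemma local_weyl p : V p -> weighted_weyl_at g (fun=> 1) local_nabla local_form p.
Proof.
move=> Vp; have cp := sV Vp; have NV := near_V Vp.
split.
- exact: smooth_at_cst.
- move=> U X Y oU Xs Ys Up.
  have Xp := smooth_vf_at oU Xs Up; have Yp := smooth_vf_at oU Ys Up.
  apply: vf_at_sum => j; apply: vf_atD.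
    apply: vf_atZ; last exact: vf_at_coord.
    by apply: smooth_at_dird => //; exact: comp_near Ys Up Vp.
  apply: vf_atZ; first exact: comp_smooth.
  by apply: vf_at_sum => i; apply: vf_atZ; [exact: comp_smooth|exact: Gams].
- move=> U X X' Y Y' oU Xs Ys EX EY Up.
  have NU : \forall q \near p, U q by exact: open_nbhs_nbhs.
  apply: eq_bigr => j _; rewrite /GamX /comp -(EX p Up) -(EY p Up).
  have -> // : dird (fun q => dird (coordf c j) q (Y q)) p (X p) =
    dird (fun q => dird (coordf c j) q (Y' q)) p (X p).
  by apply: dird_ext; apply: filterS NU => q Uq; rewrite EY.
- move=> U X X' Y oU Xs Xs' Ys Up; rewrite /local_nabla -big_split; apply: eq_bigr => j _ /=.
  have Ycs := comp_smooth j Vp (smooth_vf_at oU Ys Up).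
  have -> : GamX (fun q => X q + X' q) p j = GamX X p j + GamX X' p j.
    by rewrite /GamX -big_split; apply: eq_bigr => i _; rewrite compD// scalerDl.
  by rewrite dird_vecD// scalerDl scalerDr addrACA.
- move=> U f X Y oU fs Xs Ys Up; rewrite /local_nabla scaler_sumr; apply: eq_bigr => j _ /=.
  have Ycs := comp_smooth j Vp (smooth_vf_at oU Ys Up).
  have -> : GamX (fun q => f q *: X q) p j = f p *: GamX X p j.
    by rewrite /GamX scaler_sumr; apply: eq_bigr => i _; rewrite compZ// scalerA.
  by rewrite dird_vecZ// scalerDr !scalerA (mulrC (comp Y j p)).
- move=> U X Y Y' oU Xs Ys Ys' Up; rewrite /local_nabla -big_split; apply: eq_bigr => j _ /=.
  have Ycs := comp_smooth j Vp (smooth_vf_at oU Ys Up).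
  have Ycs' := comp_smooth j Vp (smooth_vf_at oU Ys' Up).
  have -> : dird (comp (fun q => Y q + Y' q) j) p (X p) =
    dird (comp Y j) p (X p) + dird (comp Y' j) p (X p).
    by rewrite -dirdD//; apply: dird_ext; apply: filterS NV => q Vq; exact: compD.
  by rewrite compD// !scalerDl addrACA.
- move=> U f X Y oU fs Xs Ys Up.
  have Yp := smooth_vf_at oU Ys Up; have fp := smooth_fun_at oU fs Up.
  rewrite mul1r [Y p in RHS](vf_decomp _ ac cp) /local_nabla !scaler_sumr -big_split.
  apply: eq_bigr => j _ /=.
  have Ycs := comp_smooth j Vp Yp.
  have -> : dird (comp (fun q => f q *: Y q) j) p (X p)
      = f p * dird (comp Y j) p (X p) + comp Y j p * dird f p (X p).
    by rewrite -dirdM//; apply: dird_ext; apply: filterS NV => q Vq; exact: compZ.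
  rewrite compZ// scalerDl scalerDr !scalerA -/(comp Y j p) (mulrC (comp Y j p)).
  by rewrite [in LHS]addrAC addrC addrA.
- move=> U X Y oU Xs Ys Up.
  have Xp := smooth_vf_at oU Xs Up; have Yp := smooth_vf_at oU Ys Up.
  rewrite scale1r [RHS](vf_decomp _ ac cp) /local_nabla !big_split/= opprD addrACA.
  have -> : \sum_j comp Y j p *: GamX X p j - \sum_j comp X j p *: GamX Y p j = 0.
    have -> : \sum_j comp X j p *: GamX Y p j
      = \sum_i \sum_j comp X j p *: (comp Y i p *: Gam i j p).
      by rewrite exchange_big/=; apply: eq_bigr => i _; rewrite scaler_sumr.
    rewrite -sumrB big1// => i _; rewrite scaler_sumr -sumrB big1// => b _.
    by rewrite !scalerA mulrC (Gamsym b i Vp) subrr.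
  rewrite addr0 -sumrB; apply: eq_bigr => j _; rewrite -scalerBl; congr (_ *: _).
  rewrite dird_lie//; apply: filterS (near_cdom cp) => q cq; exact: smooth_at_coordf.
- move=> U X oU Xs Up; have Xp := smooth_vf_at oU Xs Up.
  apply: (@smooth_at_ext _ _ _ _ (fun q => \sum_i t i q * comp X i q)).
    by apply: filterS NV => q Vq; rewrite local_form_app.
  by apply: smooth_at_sum => i _; apply: smooth_atM; [exact: ts|exact: comp_smooth].
move=> U X Y Z oU Xs Ys Zs Up.
have Xp := smooth_vf_at oU Xs Up; have Yp := smooth_vf_at oU Ys Up.
have Zp := smooth_vf_at oU Zs Up.
have Yc j := comp_smooth j Vp Yp; have Zc j := comp_smooth j Vp Zp.
have Gs i j : smooth_at p (tcoef g c i j) by exact: smooth_tcoef.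
have dG j l : dird (tcoef g c j l) p (X p) =
    mval g p (GamX X p j) (coord_vf c l p) + mval g p (coord_vf c j p) (GamX X p l)
    + form_app (local_form p) (X p) * tcoef g c j l p.
  rewrite (dird_chart _ ac cp)// local_form_app// mval_suml mval_sumr mulr_suml -!big_split.
  by apply: eq_bigr => i _ /=; rewrite mvalZl mvalZr (Gamg _ _ _ Vp) /comp; ring.
rewrite mul1r (@dird_ext _ _ _ _ _
  (fun q => \sum_i \sum_j tcoef g c i j q * (comp Y i q * comp Z j q))); last first.
  by apply: filterS (near_cdom cp) => q cq; rewrite (mval_tcoef _ _ _ ac cq).
have EZ : mval g p (local_nabla X Y p) (Z p)
    = mval g p (local_nabla X Y p) (\sum_j comp Z j p *: coord_vf c j p).
  by rewrite /comp -(vf_decomp (Z p) ac cp).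
have EY : mval g p (Y p) (local_nabla X Z p)
    = mval g p (\sum_j comp Y j p *: coord_vf c j p) (local_nabla X Z p).
  by rewrite /comp -(vf_decomp (Y p) ac cp).
rewrite EZ EY (mval_tcoef g (Y p) (Z p) ac cp) /local_nabla.
rewrite dird_sum; last first.
  by move=> i; apply: smooth_at_sum => j _; apply: smooth_atM => //; exact: smooth_atM.
rewrite !mval_suml -!sumrB mulr_sumr; apply: eq_bigr => i _ /=.
rewrite dird_sum; last by move=> j; apply: smooth_atM => //; exact: smooth_atM.
rewrite !mval_sumr -!sumrB mulr_sumr; apply: eq_bigr => j _ /=.
rewrite dirdM//; last exact: smooth_atM.
rewrite dirdM// dG !mvalDl !mvalDr !mvalZl !mvalZr.
rewrite -/(comp Y i p) -/(comp Z j p) -!tcoefE; ring.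
Qed.

End LocalConnection.

(** * Coordinate frames *)

Section Frame.
Context {R : realType} {m : nat} {M : manifold R m}.
Context {c : chart R M m} {q : M}.
Hypotheses (ac : atlas M c) (cq : cdom c q).

Lemma dird_coordf_frame (x : 'I_m -> R) k :
  dird (coordf c k) q (\sum_j x j *: coord_vf c j q) = x k.
Proof.
have S : smooth_at q (coordf c k) by exact: smooth_at_coordf.
rewrite dird_vec_sum// (bigD1 k)//= big1 => [|j jk].
  by rewrite dird_vecZ// dird_coordf_coord_vf// eqxx mulr1 addr0.
by rewrite dird_vecZ// dird_coordf_coord_vf// (negbTE jk) mulr0.
Qed.

Lemma tcoef_mx (g : tensor02 M) : let P := \matrix_(i < m) coord_vf c i q in
  \matrix_(i, j) tcoef g c i j q = P *m g q *m P^T.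
Proof.
apply/matrixP => i j; rewrite mxE tcoef.unlock mval.unlock /bil.
rewrite -(rowK (fun i => coord_vf c i q) i) -(rowK (fun i => coord_vf c i q) j).
rewrite -row_mul [LHS]mxE [RHS]mxE; apply: eq_bigr => k _.
by congr (_ * _); rewrite !mxE.
Qed.

Lemma frame_unit : \matrix_(i < m) coord_vf c i q \in unitmx.
Proof.
rewrite -row_free_unit -kermx_eq0; apply/rowV0P => u /sub_kermxP.
rewrite mulmx_sum_row => u0; apply/rowP => k; rewrite mxE.
rewrite -(dird_coordf_frame (fun j => u 0 j) k).
have -> : \sum_j u 0 j *: coord_vf c j q = 0.
  by rewrite -[RHS]u0; apply: eq_bigr => j _; rewrite rowK.
exact: dird_coordf0.
Qed.

Lemma rank_tcoef (g : tensor02 M) : (g q)^T = g q ->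
  \rank (\matrix_(i, j) tcoef g c i j q) = \rank (g q).
Proof.
move=> sg; rewrite tcoef_mx mxrankMfree; last by rewrite row_free_unit unitmx_tr frame_unit.
rewrite -mxrank_tr trmx_mul sg mxrankMfree// row_free_unit unitmx_tr; exact: frame_unit.
Qed.

End Frame.

(** * Umbilicity implies a Weyl connection *)

Section KoszulCoord.
Context {R : realType} {m : nat} {M : manifold R m} (g : tensor02 M) (c : chart R M m).

(** The brackets of coordinate fields vanish. *)
Lemma koszul_coord i j l p : smooth_tensor02 g -> atlas M c -> cdom c p ->
  koszul g (coord_vf c i) (coord_vf c j) (coord_vf c l) p =
  partial c i (tcoef g c j l) p + partial c j (tcoef g c i l) p - partial c l (tcoef g c i j) p.
Proof.
move=> gs ac cp.
have D a b e : dird (fun q => mval g q (coord_vf c a q) (coord_vf c b q)) p (coord_vf c e p)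
    = partial c e (tcoef g c a b) p.
  by rewrite -(dird_coord_vf e ac cp (smooth_tcoef a b gs ac cp)) tcoef.unlock.
have L a b v : mval g p (lie (coord_vf c a) (coord_vf c b) p) v = 0.
  by rewrite lie_coord// mval.unlock bil0l.
transitivity (partial c i (tcoef g c j l) p + partial c j (tcoef g c i l) p
  - partial c l (tcoef g c i j) p + 0 - 0 - 0).
  congr (_ + _ - _ + _ - _ - _); [exact: D|exact: D|exact: D|exact: L|exact: L|exact: L].
by rewrite !subr0 addr0.
Qed.

End KoszulCoord.

Section Pullback.
Context {R : realType} {m k : nat} {M : manifold R m} {N : manifold R k}.
Context {F : M -> N} {h : tensor02 N}.
Hypotheses (smF : smooth_map F) (smh : smooth_tensor02 h).

Lemma smooth_pullback : smooth_tensor02 (pullback F h).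
Proof.
move=> U X Y oU Xs Ys; apply/smooth_funP => // p Up.
have Xp := smooth_vf_at oU Xs Up; have Yp := smooth_vf_at oU Ys Up.
have ac := chart_at_atlas (F p); have cp := chart_at_dom (F p).
move: (chart_at (F p)) ac cp => c ac cp.
apply: (@smooth_at_ext _ _ _ _ (fun q => \sum_i \sum_j tcoef h c i j (F q) *
   (dird (fun q => coordf c i (F q)) q (X q) * dird (fun q => coordf c j (F q)) q (Y q)))).
  apply: filterS (near_smooth_map smF (near_cdom cp)) => q cq.
  rewrite mvalE (mval_pullback smF) (mval_tcoef _ _ _ ac cq).
  by apply: eq_bigr => i _; apply: eq_bigr => j _; rewrite !dird_tmap//; exact:
    smooth_at_coordf.
apply: smooth_at_sum => i _; apply: smooth_at_sum => j _; apply: smooth_atM.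
  by apply: smooth_at_pull => //; exact: smooth_tcoef.
by apply: smooth_atM; apply: smooth_at_tmap.
Qed.

End Pullback.

Section Existence.
Context {R : realType} {n : nat} {M : manifold R n.+1} {N : manifold R n.+2}.
Context {gbar : tensor02 N} {Dbar : connection N} {iota : M -> N}.
Hypotheses (smi : smooth_map iota) (smg : smooth_tensor02 gbar)
  (symg : forall y, (gbar y)^T = gbar y) (LC : levi_civita gbar Dbar)
  (rk : forall p, \rank (pullback iota gbar p) = n)
  (umb : totally_umbilical iota gbar Dbar).

Let g := pullback iota gbar.

Let sg p : (g p)^T = g p. Proof. exact: pullback_sym. Qed.

Let gs : smooth_tensor02 g. Proof. exact: smooth_pullback. Qed.

(** In a chart with coefficients G_ij the Christoffel fields of a torsion-free
    connection with nabla g = theta (x) g must solve Gam_ij^k G_kl = w_ij,l, where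
    w_ij,l is half of d_i G_jl + d_j G_il - d_l G_ij
    - theta_i G_jl - theta_j G_il + theta_l G_ij. Such a system is solvable if and
    only if w_ij is orthogonal to the kernel vector xi of G. By the Koszul formula
    its product with xi is B_ij + theta(xi) G_ij / 2, and B_ij = lambda G_ij; so
    any theta with theta(xi) = - 2 lambda will do. *)
Lemma umbilical_local_weyl p0 : exists (V : set M) T th, [/\ open V, V p0 &
  forall p, V p -> weighted_weyl_at g (fun=> 1) T th p].
Proof.
have ac := chart_at_atlas p0; have cp := chart_at_dom p0.
move: (chart_at p0) ac cp => c ac cp.
pose G i j := tcoef g c i j.
have GC i j : G i j = G j i.
  by apply: funext => q; rewrite /G !tcoef.unlock; exact: (mvalC _ _ (sg q)).
have Gs i j p : cdom c p -> smooth_at p (G i j) by move=> ?; exact: smooth_tcoef.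
pose Gmx q := \matrix_(i, j) G i j q.
have symG q : (Gmx q)^T = Gmx q by apply/matrixP => i j; rewrite !mxE GC.
have rkG q : cdom c q -> \rank (Gmx q) = n.
  by move=> cq; rewrite -[RHS](rk q); exact: rank_tcoef.
have [v v0 vG] := corank1_kernel (rkG p0 cp).
(* near p0 the kernel is then spanned by a vector with a-th entry 1 *)
have [a va] := rV0Pn _ v0.
pose B q := completed_mx (Gmx q) a.
have Bs i j p : cdom c p -> smooth_at p (fun q => B q i j).
  move=> cp'; apply: (@smooth_at_ext _ _ _ _
    (fun q => G i j q + (delta_mx a a : 'M[R]_n.+1) i j)).
    by apply: near_everywhere => q; rewrite [RHS]mxE [in RHS]mxE.
  by apply: smooth_atD; [exact: Gs|exact: smooth_at_cst].
pose V : set M := [set q | cdom c q /\ B q \in unitmx].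
have Vp0 : V p0 by split=> //; exact: completed_mx_unit (symG p0) (rkG p0 cp) vG va.
have oV : open V.
  rewrite openE => q [cq uq]; apply: near_and (near_cdom cq) _.
  have cd : {for q, continuous (fun q => \det (B q))}.
    by apply: smooth_at_continuous; apply: smooth_at_det => i j; exact: Bs.
  have N0 : nbhs (\det (B q)) [set z | z != 0].
    apply: open_nbhs_nbhs; split; first exact: open_neq.
    by rewrite /= -unitfE -unitmxE.
  have := continuous_near cd N0; apply: filterS => r /=.
  by rewrite unitmxE unitfE.
have sV : V `<=` cdom c by move=> q [].
have NV q : V q -> \forall r \near q, V r by move=> Vq; exact: open_nbhs_nbhs.
have Bis i j p : V p -> smooth_at p (fun q => invmx (B q) i j).
  move=> Vp; apply: smooth_at_invmx => [i' j'|]; first exact: Bs (sV _ Vp).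
  by apply: filterS (NV p Vp) => q [].
pose x k q := invmx (B q) a k.
pose xi q := \sum_k x k q *: coord_vf c k q.
have xG q j : V q -> \sum_i G i j q * x i q = 0.
  move=> [cq uq]; have [+ _] := completed_mx_kernel (rkG q cq) uq.
  move=> /rowP/(_ j); rewrite !mxE => E; rewrite -[RHS]E.
  by apply: eq_bigr => i _; rewrite /Gmx !mxE mulrC.
have xa q : V q -> x a q = 1.
  by move=> [cq uq]; have [_] := completed_mx_kernel (rkG q cq) uq; rewrite mxE.
have gxi q u : V q -> mval g q (xi q) u = 0.
  move=> Vq; have cq := sV _ Vq; rewrite (mval_tcoef _ _ _ ac cq) exchange_big big1// => j _.
  under eq_bigr do rewrite (dird_coordf_frame ac cq) mulrA.
  by rewrite -mulr_suml xG// mul0r.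
have xis : smooth_vf V xi.
  apply/smooth_vfP => // p Vp; apply: vf_at_sum => k; apply: vf_atZ; first exact: Bis.
  exact: vf_at_coord (sV _ Vp).
have nor : normal_section iota gbar (cdom (restrict_chart oV sV)) xi.
  split=> // p Vp; split.
    apply/negP => /eqP xi0; have := dird_coordf_frame ac (sV _ Vp) (fun k => x k p) a.
    rewrite -/(xi p) xi0 dird_coordf0//; last exact: (sV p Vp).
    by rewrite xa// => /eqP; rewrite eq_sym oner_eq0.
  move=> u; rewrite (mvalE gbar (iota p)) -(mval_pullback smi); exact: gxi.
have [lam [lams lamE]] := umb (restrict_chart_atlas oV sV ac) nor.
have lam_at p : V p -> smooth_at p lam by move=> Vp; exact: smooth_fun_at oV lams Vp.
have coordV i : smooth_vf V (coord_vf c i).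
  by apply/smooth_vfP => // p Vp; exact: vf_at_coord (sV _ Vp).
(* theta = - 2 lambda dx^a, and the a-th component of xi is 1 *)
pose t i q := - 2 * lam q * (i == a)%:R.
have ts i p : V p -> smooth_at p (t i).
  move=> Vp; apply: smooth_atM; last exact: smooth_at_cst.
  by apply: smooth_atM; [exact: smooth_at_cst|exact: lam_at].
pose w i j q : 'rV[R]_n.+1 := \row_l
  (2^-1 * (partial c i (G j l) q + partial c j (G i l) q - partial c l (G i j) q
   - t i q * G j l q - t j q * G i l q + t l q * G i j q)).
have ws i j l p : V p -> smooth_at p (fun q => w i j q 0 l).
  move=> Vp; have cp' := sV _ Vp.
  apply: (@smooth_at_ext _ _ _ _ (fun q =>
    2^-1 * (partial c i (G j l) q + partial c j (G i l) q - partial c l (G i j) q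
   - t i q * G j l q - t j q * G i l q + t l q * G i j q))).
    by apply: near_everywhere => q; rewrite mxE.
  have Ps i' j' l' : smooth_at p (partial c i' (G j' l')) by apply: smooth_at_partial => //;
    exact: Gs.
  have Ts i' j' l' : smooth_at p (fun q => t i' q * G j' l' q).
    by apply: smooth_atM; [exact: ts|exact: Gs].
  apply: smooth_atM; first exact: smooth_at_cst.
  by apply: smooth_atD => //; apply: smooth_atB => //; apply: smooth_atB => //;
    apply: smooth_atB => //; exact: smooth_atD.
pose gam i j q := w i j q *m invmx (B q).
pose Gam i j q := \sum_k gam i j q 0 k *: coord_vf c k q.
have wC i j q : w i j q = w j i q.
  by apply/rowP => l; rewrite !mxE (GC i j); ring.
(* umbilicity enters here, through the Koszul formula along iota *)
have wxi i j q : V q -> w i j q *m (row a (invmx (B q)))^T = 0.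
  move=> Vq; have cq := sV _ Vq; apply/matrixP => i0 j0; rewrite !ord1 [RHS]mxE mxE.
  transitivity (2^-1 * (\sum_l x l q * koszul g (coord_vf c i) (coord_vf c j) (coord_vf c l) q
      - t i q * (\sum_l G l j q * x l q) - t j q * (\sum_l G l i q * x l q)
      + (\sum_l t l q * x l q) * G i j q)).
    rewrite !mulr_sumr mulr_suml -!sumrB -big_split mulr_sumr; apply: eq_bigr => l _ /=.
    rewrite koszul_coord// !mxE -/(x l q) -/(G j l) -/(G i l) -/(G i j) (GC l j) (GC l i); ring.
  rewrite !xG// !mulr0 !subr0.
  have -> : \sum_l t l q * x l q = - 2 * lam q.
    rewrite (bigD1 a)//= big1 => [|l la]; last by rewrite /t (negbTE la) mulr0 mul0r.
    by rewrite /t eqxx mulr1 xa// mulr1 addr0.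
  have -> : \sum_l x l q * koszul g (coord_vf c i) (coord_vf c j) (coord_vf c l) q
      = 2 * (lam q * G i j q).
    have := lamE _ _ (coordV i) (coordV j) q Vq.
    rewrite /second_form (mvalE gbar (iota q)) (mvalE g q) tcoefE => <-.
    have cv l : vf_at q (coord_vf c l) by exact: vf_at_coord.
    rewrite /xi (tmap_sum smi) mval_sumr mulr_sumr; apply: eq_bigr => l _.
    rewrite (tmapZ smi) mvalZr -(koszul_along smi smg symg LC (cv i) (cv j) (cv l)); ring.
  by ring.
have GamE i j l q : V q -> mval g q (Gam i j q) (coord_vf c l q) = w i j q 0 l.
  move=> Vq; have [cq uq] := Vq; rewrite mval_suml.
  have := completed_mx_solve (symG q) (rkG q cq) uq (wxi i j q Vq).
  move=> /rowP/(_ l) <-; rewrite [RHS]mxE; apply: eq_bigr => k _.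
  by rewrite mvalZl tcoefE; congr (_ * _); rewrite mxE.
exists V, (local_nabla c Gam), (local_form c t); split=> // p Vp.
apply: (@local_weyl _ _ _ g c V Gam t gs ac oV sV) => //.
- move=> i j q Vq; apply: vf_at_sum => k; apply: vf_atZ; last exact: vf_at_coord (sV _ Vq).
  apply: (@smooth_at_ext _ _ _ _ (fun q => \sum_l w i j q 0 l * invmx (B q) l k)).
    by apply: near_everywhere => r; rewrite [RHS]mxE.
  by apply: smooth_at_sum => l _; apply: smooth_atM; [exact: ws|exact: Bis].
- by move=> i j q Vq; rewrite /Gam /gam wC.
- move=> i j l q Vq; rewrite GamE// mvalC// GamE// !mxE -!/(G _ _).
  by rewrite (GC l j); field.
Qed.

Lemma umbilical_weyl : exists D : connection M, weyl_connection g D.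
Proof.
have [|T [th W]] := @weighted_weyl_glue R n.+1 M g; last exact: weyl_of_weighted W.
move=> p0; have [V [T [th [oV Vp0 W]]]] := umbilical_local_weyl p0.
have [b [T' [th' [W' b1]]]] := weighted_weyl_extend oV Vp0 W.
by exists (b, T', th').
Qed.

End Existence.

(** * The theorem *)

Theorem theorem5p1 (R : realType) (n nu : nat)
    (Mbar : manifold R n.+2) (gbar : tensor02 Mbar) (Dbar : connection Mbar)
    (M : manifold R n.+1) (iota : M -> Mbar)
    (nu_gt0 : (0 < nu)%N) (nu_lt : (nu < n.+2)%N)
    (gbar_metric : pseudo_riemannian gbar nu)
    (Dbar_LC : levi_civita gbar Dbar)
    (M_lightlike : lightlike_hypersurface gbar iota) :
  totally_umbilical iota gbar Dbar <->
  exists D : connection M, weyl_connection (pullback iota gbar) D.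
Proof.
have [_ [smi _] rk] := M_lightlike; have [smg met] := gbar_metric.
have symg y : (gbar y)^T = gbar y by have [] := met y.
split=> [umb|[D]]; first exact: umbilical_weyl smi smg symg Dbar_LC rk umb.
exact: weyl_umbilical.
Qed.
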